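(* Assume that $k$ is a translational invariant kernel with finite smoothness $\tau>d/2$. Let $\Omega\subset\mathbb{R}^d$ be a bounded domain and let $(X_N)_{N\in\mathbb{N}}$ be a sequence of sets of points within $\Omega$, where $X_N$ consists of $N$ pairwise distinct points. Then there exists a constant $c_P>0$ such that for all $N\in\mathbb{N}$ $$\|P_N\|_{L^\infty(\Omega)}\ge c_P\cdot N^{\frac12-\frac{\tau}{d}} .$$
   Context: A kernel on $\Omega\subset\mathbb{R}^d$ is a symmetric function $k:\Omega\times\Omega\to\mathbb{R}$; it is strictly positive definite if for all finite sets of pairwise distinct points $X_N=\{x_1,\dots,x_N\}\subset\Omega$ the matrix $(k(x_i,x_j))_{i,j}$ is positive definite. Its native space $\mathcal{H}_k(\Omega)$ is the unique reproducing kernel Hilbert space of functions on $\Omega$ with reproducing kernel $k$. For a finite set $X_N=\{x_1,\dots,x_N\}\subset\Omega$ of pairwise distinct points, $V(X_N)=\mathrm{span}\{k(\cdot,x_i):x_i\in X_N\}$ and $\Pi_{V(X_N)}$ is the orthogonal projection of $\mathcal{H}_k(\Omega)$ onto $V(X_N)$. The Power function is $P_N(x)=P_{X_N}(x)=\|k(\cdot,x)-\Pi_{V(X_N)}(k(\cdot,x))\|_{\mathcal{H}_k(\Omega)}$. $k$ is translational invariant if $k(x,y)=\Phi(x-y)$ for some $\Phi:\mathbb{R}^d\to\mathbb{R}$. It is a kernel of finite smoothness $\tau>d/2$ if its native space is norm equivalent to the Sobolev space $W_2^\tau$; for translational invariant kernels this is the situation in which $c_\Phi(1+\|\omega\|_2^2)^{-\tau}\le\hat\Phi(\omega)\le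 C_\Phi(1+\|\omega\|_2^2)^{-\tau}$ for all $\omega\in\mathbb{R}^d$ with constants $c_\Phi,C_\Phi>0$, so that $\mathcal{H}_k(\mathbb{R}^d)$ is norm equivalent to $W_2^\tau(\mathbb{R}^d)$, and it is assumed throughout that the boundary of $\Omega$ is regular enough that also $\mathcal{H}_k(\Omega)$ is norm equivalent to $W_2^\tau(\Omega)$. *)

(* Defs.v *)
From HB Require Import structures.
From mathcomp Require Import all_boot all_order all_algebra.
From mathcomp Require Import all_classical all_reals all_analysis.

Set Implicit Arguments.
Unset Strict Implicit.
Unset Printing Implicit Defensive.

Import Order.TTheory GRing.Theory Num.Theory.
Import numFieldNormedType.Exports.

Local Open Scope classical_set_scope.
Local Open Scope ring_scope.

(** Points of R^d are row vectors
    ['rV[R]_d]; their topology is the library's (max-norm) one, while the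
    Euclidean norm is [enorm] below. *)

Section image_measure.
Context d1 d2 (T1 : measurableType d1) (T2 : measurableType d2).
Context (R : realType) (m : {measure set T1 -> \bar R}) (f : T1 -> T2).
Hypothesis mf : measurable_fun [set: T1] f.

(* [pushforward m f] bundled as a measure by means of the proof [mf]. *)
Definition image_measure : {measure set T2 -> \bar R} :=
  measure_function_pushforward__canonical__measure_function_Measure m mf.

End image_measure.

Section lebesgue_tuple.
Context {R : realType}.

Definition cons_pair n (p : measurableTypeR R * n.-tuple (measurableTypeR R)) :
    n.+1.-tuple (measurableTypeR R) :=
  [the n.+1.-tuple (measurableTypeR R) of p.1 :: p.2].

Lemma measurable_cons_pair n : measurable_fun setT (@cons_pair n).
Proof. exact: measurable_cons. Qed.

Fixpoint lebesgue_tuple n :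
    {measure set (n.-tuple (measurableTypeR R)) -> \bar R} :=
  if n is n'.+1
  then image_measure
         [the measure _ _ of (@lebesgue_measure R \x^ lebesgue_tuple n')%E]
         (@measurable_cons_pair n')
  else [the measure _ _ of dirac [tuple]].

End lebesgue_tuple.

Definition rV_display : measure_display.
Proof. exact: default_measure_display. Qed.

Section lebesgue_rV.
Context {R : realType} {d : nat}.

Definition rV_coord (i : 'I_d) (x : 'rV[R]_d) : measurableTypeR R := x ord0 i.

(* The sigma-algebra generated by the coordinates, i.e. the Borel one. *)
HB.instance Definition _ := @isMeasurable.Build rV_display 'rV[R]_d
  (g_sigma_preimage rV_coord) (@sigma_algebra0 _ setT _)
  (@sigma_algebraC _ _) (@sigma_algebra_bigcup _ setT _).

Definition rV_of_tuple (t : d.-tuple (measurableTypeR R)) : 'rV[R]_d :=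
  \row_i tnth t i.

Lemma measurable_rV_of_tuple : measurable_fun setT rV_of_tuple.
Proof.
move=> _ A mA; rewrite setTI.
have := @g_sigma_preimage_comp _ (measurableTypeR R) d 'rV[R]_d rV_coord
  _ rV_of_tuple.
have -> : (fun i => rV_coord i \o rV_of_tuple) = (fun i t => tnth t i).
  by apply/funext => i; apply/funext => t; rewrite /rV_coord /= mxE.
by rewrite /measurable/= => ->; exists A => //; rewrite setTI.
Qed.

Definition lebesgue_rV : {measure set 'rV[R]_d -> \bar R} :=
  image_measure (lebesgue_tuple d) measurable_rV_of_tuple.

End lebesgue_rV.

Section smooth_functions.
Context {R : realType} {d : nat}.
Implicit Types (f phi : 'rV[R]_d -> R) (x y : 'rV[R]_d) (Omega : set 'rV[R]_d).

Definition dotv x y : R := \sum_(i < d) x ord0 i * y ord0 i.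
Definition enorm x : R := Num.sqrt (dotv x x).

Fixpoint partials (s : seq 'I_d) f : 'rV[R]_d -> R :=
  if s is i :: s' then fun x => 'D_(delta_mx ord0 i) (partials s' f) x else f.

Definition smooth f := forall s : seq 'I_d,
  continuous (partials s f) /\
  forall i x, derivable (partials s f) x (delta_mx ord0 i).

Definition schwartz phi := smooth phi /\
  forall (n : nat) (s : seq 'I_d), exists M : R,
    forall x, (1 + enorm x) ^+ n * `|partials s phi x| <= M.

Definition test_function Omega phi := [/\ smooth phi,
  compact (closure [set x | phi x != 0]) &
  closure [set x | phi x != 0] `<=` Omega].

(* Real and imaginary part of
   (2 pi)^(-d/2) \int phi(x) exp(- i <x, w>) dx, for real-valued phi. *)
Definition fourier_re phi (w : 'rV[R]_d) : R :=
  (2 * pi) `^ (- (d%:R / 2)) *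
  \int[lebesgue_rV]_(x in setT) (phi x * cos (dotv x w)).
Definition fourier_im phi (w : 'rV[R]_d) : R :=
  - ((2 * pi) `^ (- (d%:R / 2)) *
     \int[lebesgue_rV]_(x in setT) (phi x * sin (dotv x w))).

(* The real-valued function [F] is the Fourier transform of [Phi] in the sense
   of tempered distributions: \int F phi = \int Phi phi^ for all Schwartz
   functions phi (real ones suffice, by linearity).  If [Phi] is integrable this
   is the usual integral formula; it also covers kernels that are not. *)
Definition is_fourier_transform (Phi F : 'rV[R]_d -> R) :=
  forall phi, schwartz phi ->
  [/\ lebesgue_rV.-integrable setT (EFin \o (F \* phi)),
      lebesgue_rV.-integrable setT (EFin \o (Phi \* fourier_re phi)),
      lebesgue_rV.-integrable setT (EFin \o (Phi \* fourier_im phi)),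
      \int[lebesgue_rV]_(w in setT) (F w * phi w) =
      \int[lebesgue_rV]_(x in setT) (Phi x * fourier_re phi x) &
      \int[lebesgue_rV]_(x in setT) (Phi x * fourier_im phi x) = 0].

Definition fourier_decay (Phi : 'rV[R]_d -> R) (tau : R) :=
  exists F : 'rV[R]_d -> R, is_fourier_transform Phi F /\
  exists c C : R, [/\ 0 < c, 0 < C &
    forall w, c * (1 + enorm w ^+ 2) `^ (- tau) <= F w <=
              C * (1 + enorm w ^+ 2) `^ (- tau)].

End smooth_functions.

Section sobolev.
Context {R : realType} {d : nat} (Omega : set 'rV[R]_d).
Implicit Types u v : 'rV[R]_d -> R.

Definition L2 u := measurable_fun Omega u /\
  (\int[lebesgue_rV]_(x in Omega) ((u x) ^+ 2)%:E < +oo)%E.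

(* Multi-indices of order at most m, and the list of partial derivatives they
   stand for. *)
Definition multi_index (m : nat) := {ffun 'I_d -> 'I_m.+1}.
Definition morder m (a : multi_index m) : nat := \sum_(i < d) a i.
Definition mpartials m (a : multi_index m) : seq 'I_d :=
  flatten [seq nseq (a i) i | i <- enum 'I_d].

Definition is_weak_derivative m (a : multi_index m) u v := L2 v /\
  forall phi, test_function Omega phi ->
    \int[lebesgue_rV]_(x in Omega) (u x * partials (mpartials a) phi x) =
    (-1) ^+ morder a * \int[lebesgue_rV]_(x in Omega) (v x * phi x).

(* Meaningful only if such a derivative exists; unique up to null sets. *)
Definition weak_derivative m (a : multi_index m) u : 'rV[R]_d -> R :=
  get (is_weak_derivative a u).

(* Square of the Slobodeckij seminorm of order s, 0 < s < 1. *)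
Definition slobodeckij (s : R) v : \bar R :=
  (\int[lebesgue_rV]_(x in Omega) \int[lebesgue_rV]_(y in Omega)
    (`|v x - v y| ^+ 2 / enorm (x - y) `^ (d%:R + 2 * s))%:E)%E.

(* For tau = m + s with m natural and 0 <= s < 1. *)
Definition sobolev (tau : R) : set ('rV[R]_d -> R) := [set u |
  let m := Num.truncn tau in let s := tau - m%:R in
  L2 u /\ forall a : multi_index m, (morder a <= m)%N ->
    (exists v, is_weak_derivative a u v) /\
    (0 < s -> morder a = m -> (slobodeckij s (weak_derivative a u) < +oo)%E)].

Definition sobolev_norm (tau : R) u : R :=
  let m := Num.truncn tau in let s := tau - m%:R in
  Num.sqrt (
    \sum_(a : multi_index m | (morder a <= m)%N)
      \int[lebesgue_rV]_(x in Omega) ((weak_derivative a u x) ^+ 2) +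
    (if 0 < s then
       \sum_(a : multi_index m | morder a == m)
         fine (slobodeckij s (weak_derivative a u))
     else 0)).

End sobolev.

Section native_space.
Context {R : realType} {T : Type}.

Definition is_kernel (k : T -> T -> R) := forall x y, k x y = k y x.

(* A Hilbert space of functions on T with reproducing kernel k; the values of
   [ns_ip] outside of [ns_car] are irrelevant. *)
Record native_space (k : T -> T -> R) := NativeSpace {
  ns_car : set (T -> R);
  ns_ip : (T -> R) -> (T -> R) -> R;
  _ : ns_car (fun=> 0);
  _ : forall (a : R) f g, ns_car f -> ns_car g ->
        ns_car (fun x => a * f x + g x);
  _ : forall f g, ns_car f -> ns_car g -> ns_ip f g = ns_ip g f;
  _ : forall (a : R) f g h, ns_car f -> ns_car g -> ns_car h ->
        ns_ip (fun x => a * f x + g x) h = a * ns_ip f h + ns_ip g h;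
  _ : forall f, ns_car f -> (exists x, f x != 0) -> 0 < ns_ip f f;
  _ : forall u : nat -> T -> R, (forall n, ns_car (u n)) ->
        (forall e : R, 0 < e -> exists n0, forall m n, (n0 <= m)%N ->
           (n0 <= n)%N -> ns_ip (u m \- u n) (u m \- u n) < e) ->
        exists2 f, ns_car f &
          (fun n => ns_ip (u n \- f) (u n \- f)) @ \oo --> (0 : R);
  _ : forall x, ns_car (k^~ x);
  _ : forall f x, ns_car f -> ns_ip f (k^~ x) = f x
}.

Context {k : T -> T -> R} (H : native_space k).

Definition ns_norm (f : T -> R) : R := Num.sqrt (ns_ip H f f).

Definition orthogonal_projection (V : set (T -> R)) (f : T -> R) : T -> R :=
  get [set p | V p /\ forall v, V v -> ns_ip H (f \- p) v = 0].

Definition kernel_span N (X : 'I_N -> T) : set (T -> R) :=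
  [set f | exists c : 'I_N -> R, f = fun y => \sum_(i < N) c i * k y (X i)].

Definition power_function N (X : 'I_N -> T) (x : T) : R :=
  ns_norm (k^~ x \- orthogonal_projection (kernel_span X) (k^~ x)).

End native_space.

Section kernels_on_Omega.
Context {R : realType} {d : nat} {Omega : set 'rV[R]_d}.

Definition extend0 (f : Omega -> R) (x : 'rV[R]_d) : R := oapp f 0 (insub x).

Definition norm_equivalent_sobolev (k : Omega -> Omega -> R)
    (H : native_space k) (tau : R) :=
  [/\ forall f, ns_car H f -> sobolev Omega tau (extend0 f),
      (* elements of W_2^tau are functions up to null sets *)
      forall u, sobolev Omega tau u -> exists2 f, ns_car H f &
        {ae lebesgue_rV, forall x, Omega x -> u x = extend0 f x} &
      exists c C : R, [/\ 0 < c, 0 < C & forall f, ns_car H f ->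
        c * sobolev_norm Omega tau (extend0 f) <= ns_norm H f <=
        C * sobolev_norm Omega tau (extend0 f)]].

(* Continuity of Phi (automatic for a kernel whose native space embeds in the
   continuous functions) picks the representative determined by the Fourier
   transform. *)
Definition translational_invariant_smoothness (k : Omega -> Omega -> R)
    (tau : R) :=
  exists Phi : 'rV[R]_d -> R,
  [/\ forall x y : Omega, k x y = Phi (\val x - \val y),
      continuous Phi & fourier_decay Phi tau].

Definition bounded_domain :=
  [/\ Omega !=set0, open Omega, connected Omega & bounded_set Omega].

End kernels_on_Omega.
Arguments bounded_domain {R d} Omega.

Definition Linfty_norm {R : realType} {d : nat} {Omega : set 'rV[R]_d}
    (f : Omega -> R) : \bar R :=
  ('N[lebesgue_rV]_+oo [EFin \o extend0 f])%E.

(* Main.v *)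
(** Write Q_Phi(c) for the quadratic form sum_(p,q) c_p c_q Phi(z_p - z_q).  Testing
    the Fourier transform of Phi against modulated Gaussians, and letting their
    width tend to 0 on the side of Phi, gives Q_Phi(c) = (2 pi)^(-d/2) times the
    integral of F |sum_p c_p e^(i <z_p, w>)|^2, or rather the consequence that
    F >= c (1 + |w|^2)^(-tau) >= c' s^tau e^(-s |w|^2) implies
    Q_Phi >= c'' s^(tau - d/2) Q_G for the Gaussian G(x) = e^(-|x|^2 / (4 s)).
    The squared power function is the value of Q_Phi at the coefficients of
    k(., x) - Pi k(., x), so it dominates c'' s^(tau - d/2) times the squared
    distance, in the native space of G, of G(., x) to the span of N kernel
    translates.  With s of order N^(-2/d) choose n^d >= 2 * 3^d * N points x, one
    in each cell of a grid of mesh proportional to sqrt s and off the null set where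
    the essential supremum is exceeded.  Their translates of G are unit vectors with
    Bessel constant 3^d, so any N-dimensional space captures at most 3^d N of
    the total squared norm n^d, and some x has squared distance at least 1/2.
    Hence sup P_N^2 is at least of order s^(tau - d/2) = N^(1 - 2 tau / d). *)

From HB Require Import structures.
Require Import Defs.
From mathcomp Require Import all_boot all_order all_algebra.
From mathcomp Require Import all_classical all_reals all_analysis.
From mathcomp Require Import measurable_realfun ess_sup_inf.
From mathcomp Require Import ring lra.

Set Implicit Arguments.
Unset Strict Implicit.
Unset Printing Implicit Defensive.

Import Order.TTheory GRing.Theory Num.Theory.
Import numFieldNormedType.Exports.

Local Open Scope classical_set_scope.
Local Open Scope ring_scope.

(** * Semi-inner products *)

Section semi_inner_product.
Variables (R : realFieldType) (E : lmodType R) (B : E -> E -> R).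
Hypothesis B_lin : forall a u v w, B (a *: u + v) w = a * B u w + B v w.
Hypothesis B_sym : forall u v, B u v = B v u.
Hypothesis B_ge0 : forall u, 0 <= B u u.

Let B_linr a u v w : B w (a *: u + v) = a * B w u + B w v.
Proof. by rewrite B_sym B_lin !(B_sym w). Qed.

Let B0l v : B 0 v = 0.
Proof. by have := B_lin (-1) 0 0 v; rewrite scaler0 addr0 mulN1r addNr. Qed.

Lemma form_suml (I : finType) (c : I -> R) (x : I -> E) v :
  B (\sum_i c i *: x i) v = \sum_i c i * B (x i) v.
Proof.
elim/big_rec2: _ => [|i a u _ <-]; first exact: B0l.
by rewrite B_lin.
Qed.

Let BB t u v : B (u - t *: v) (u - t *: v) = B u u - 2 * t * B u v + t ^+ 2 * B v v.
Proof.
by rewrite addrC -scaleNr B_lin !B_linr (B_sym v u); ring.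
Qed.

(** Otherwise [B (u - t *: v) (u - t *: v)] would be affine and nonconstant in [t], hence negative
    somewhere; the [t] chosen below gives [- B u u - 2]. *)
Lemma form_isotropic u v : B v v = 0 -> B u v = 0.
Proof.
move=> v0; apply/eqP/negPn/negP => uv0.
have := B_ge0 (u - ((B u u + 1) / B u v) *: v).
by rewrite BB v0 mulr0 addr0 -mulrA divfK//; have := B_ge0 u; lra.
Qed.

(** Orthogonal projection onto the complement of [v]. For isotropic [v] the division by zero gives 0
    and [proj v] is the identity, as it should be since such a [v] is orthogonal to everything. *)
Let proj v u := u - (B u v / B v v) *: v.

Let proj_lin v a u w : proj v (a *: u + w) = a *: proj v u + proj v w.
Proof.
rewrite /proj B_lin mulrDl scalerDl -mulrA -scalerA scalerBr opprD.
by rewrite !addrA; congr (_ + _); rewrite -!addrA [w + _]addrC.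
Qed.

Let proj0 v : proj v 0 = 0.
Proof. by rewrite /proj B0l mul0r scale0r subr0. Qed.

Let proj_sum v (I : finType) (c : I -> R) (x : I -> E) :
  proj v (\sum_i c i *: x i) = \sum_i c i *: proj v (x i).
Proof.
elim/big_rec2: _ => [|i a u _ <-]; first exact: proj0.
by rewrite proj_lin.
Qed.

Let B_proj v u w : B (proj v u) w = B u w - B u v * B v w / B v v.
Proof.
rewrite /proj addrC -scaleNr B_lin; ring.
Qed.

Let B_projC v u w : B (proj v u) w = B u (proj v w).
Proof. by rewrite B_proj [RHS]B_sym B_proj !(B_sym w) (B_sym v u); ring. Qed.

Let B_proj2 v u : B (proj v u) (proj v u) = B u u - B u v ^+ 2 / B v v.
Proof.
have [v0|v0] := eqVneq (B v v) 0.
  by rewrite /proj v0 invr0 !mulr0 scale0r !subr0.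
by rewrite BB; field.
Qed.

Let B_proj_le t v u : B (proj v u) (proj v u) <= B (u - t *: v) (u - t *: v).
Proof.
rewrite B_proj2 BB; have [v0|v0] := eqVneq (B v v) 0.
  by rewrite v0 (form_isotropic u v0) expr0n; lra.
have v_gt0 : 0 < B v v by rewrite lt_def v0 B_ge0.
rewrite -subr_ge0.
have -> : B u u - 2 * t * B u v + t ^+ 2 * B v v - (B u u - B u v ^+ 2 / B v v)
  = B v v * (t - B u v / B v v) ^+ 2 by field.
by rewrite mulr_ge0 ?sqr_ge0 ?ltW.
Qed.

(* Dividing out one of the N vectors at a time preserves the Bessel inequality
   and costs at most [L] in the sum of the squared norms. *)
Lemma sum_dist_span_ge (J : finType) (L : R) N (y : J -> E) (x : 'I_N -> E)
    (c : J -> 'I_N -> R) : 0 <= L ->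
  (forall v, \sum_j B (y j) v ^+ 2 <= L * B v v) ->
  \sum_j B (y j) (y j) - N%:R * L <=
  \sum_j B (y j - \sum_i c j i *: x i) (y j - \sum_i c j i *: x i).
Proof.
move=> L0; elim: N y x c => [|N IH] y x c bes.
  by rewrite mul0r subr0 ler_sum// => j _; rewrite big_ord0 subr0.
set v := x ord0.
apply: (@le_trans _ _ (\sum_j B (proj v (y j)) (proj v (y j)) - N%:R * L)).
  under [X in _ <= X - _]eq_bigr do rewrite B_proj2.
  rewrite sumrB -addn1 natrD mulrDl mul1r opprD [- _ - _]addrC addrA lerD2r.
  rewrite lerD2l lerN2 -mulr_suml.
  have [v0|v0] := eqVneq (B v v) 0; first by rewrite v0 invr0 mulr0.
  by rewrite ler_pdivrMr ?bes// lt_def v0 B_ge0.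
apply: (le_trans (IH _ (fun i => proj v (x (lift ord0 i)))
  (fun j i => c j (lift ord0 i)) _)).
  (* The projected family keeps the Bessel constant [L]: self-adjointness moves [proj v] onto [w],
     and projecting does not increase the form. *)
  move=> w; under eq_bigr do rewrite B_projC.
  apply: (le_trans (bes _)); rewrite ler_wpM2l// B_proj2.
  by rewrite gerBl divr_ge0 ?sqr_ge0 ?B_ge0.
(* The projected residual is [proj v u], where [u] omits the term in [v]. Subtracting any multiple
   of [v] from [u], here by [c j ord0], leaves at least as much. *)
apply: ler_sum => j _; rewrite big_ord_recl opprD addrCA addrC -/v.
set u := y j - _; set p := _ - _; have -> : p = proj v u.
  rewrite /p /u -(proj_sum v _ (fun i => x (lift ord0 i))) -[in RHS]scaleN1r.
  by rewrite [in RHS]addrC proj_lin scaleN1r addrC.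
exact: B_proj_le.
Qed.

Lemma form_cauchy_schwarz u v : B u v ^+ 2 <= B u u * B v v.
Proof.
have [v0|v0] := eqVneq (B v v) 0.
  by rewrite v0 (form_isotropic u v0) expr0n mulr0.
have v_gt0 : 0 < B v v by rewrite lt_def v0 B_ge0.
by rewrite -ler_pdivrMr// -subr_ge0 -B_proj2 B_ge0.
Qed.

(** Schur test: row sums bound the largest eigenvalue of the Gram matrix. For
    [w = \sum_j B (y j) v *: y j] one has [B w v = S] and [B w w <= L * S], so Cauchy-Schwarz gives
    [S ^+ 2 <= L * S * B v v]. *)
Lemma bessel_row_sum (J : finType) (L : R) (y : J -> E) v : 0 <= L ->
  (forall j, \sum_i `|B (y j) (y i)| <= L) ->
  \sum_j B (y j) v ^+ 2 <= L * B v v.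
Proof.
move=> L0 rows; set S := \sum_j _.
pose w := \sum_j B (y j) v *: y j.
have Bwv : B w v = S by rewrite form_suml; apply: eq_bigr => j _; rewrite expr2.
have S0 : 0 <= S by apply: sumr_ge0 => j _; exact: sqr_ge0.
have Bww : B w w <= L * S.
  rewrite form_suml.
  under eq_bigr do rewrite (B_sym _ w) form_suml mulr_sumr.
  (* The mean inequality splits each product of two coefficients into squares, so that every square
     meets a whole row of the Gram matrix. *)
  pose q i j := `|B (y j) (y i)| * B (y i) v ^+ 2.
  apply: (@le_trans _ _ (\sum_i \sum_j (q i j + q j i) / 2)).
    apply: ler_sum => i _; apply: ler_sum => j _.
    rewrite /q (B_sym (y i) (y j)) -mulrDr.
    apply: le_trans (ler_norm _) _.
    rewrite mulrA !normrM [leLHS]mulrC -[leRHS]mulrA ler_wpM2l//.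
    rewrite ler_pdivlMr// -!(real_normK (num_real (B _ v))).
    have := sqr_ge0 (`|B (y i) v| - `|B (y j) v|); nra.
  under eq_bigr do rewrite -mulr_suml big_split/=.
  rewrite -mulr_suml big_split/= [X in _ + X]exchange_big/= -mulr2n.
  rewrite -[X in X / _]mulr_natr mulfK// /S mulr_sumr; apply: ler_sum => i _.
  rewrite /q -mulr_suml ler_wpM2r ?sqr_ge0//.
  by under eq_bigr do rewrite B_sym; exact: rows.
have [->|S_neq0] := eqVneq S 0; first by rewrite mulr_ge0.
have S_gt0 : 0 < S by rewrite lt_def S_neq0.
rewrite -(ler_pM2l S_gt0) -expr2 -Bwv (le_trans (form_cauchy_schwarz _ _))//.
by rewrite mulrCA mulrA Bwv ler_wpM2r.
Qed.

End semi_inner_product.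

(** * The power function as a quadratic form *)

Section power_function_form.
Context {R : realType} {T : Type} {k : T -> T -> R} (H : native_space k).
Hypothesis k_sym : is_kernel k.

Definition kcomb (I : finType) (c : I -> R) (z : I -> T) : T -> R :=
  fun y => \sum_p c p * k y (z p).

Lemma kcomb_car (I : finType) (c : I -> R) (z : I -> T) : ns_car H (kcomb c z).
Proof.
case: H => car ip h0 hlin _ _ _ _ hk _ /=.
rewrite /kcomb; elim: (index_enum I) => [|i r IH].
  by rewrite (_ : (fun _ => _) = (fun=> 0))//; apply/funext => y; rewrite big_nil.
rewrite (_ : (fun _ => _) = (fun y => c i * k y (z i) + \sum_(p <- r) c p * k y (z p))).
  exact: hlin.
by apply/funext => y; rewrite big_cons.
Qed.

Lemma ns_ip_kcomb (I : finType) (c : I -> R) (z : I -> T) g : ns_car H g ->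
  ns_ip H g (kcomb c z) = \sum_p c p * g (z p).
Proof.
case: H => car ip h0 hlin hsym hiplin hpos _ hk hrepr /= cg.
have ip0 : ip (fun=> 0) g = 0.
  have z0 : (fun=> 0) = (fun y : T => -1 * (fun=> 0 : R) y + (fun=> 0) y).
    by apply/funext => y; rewrite mulr0 addr0.
  by rewrite z0 hiplin// mulN1r addNr.
(* Membership and value are proved together, since [ns_ip] is linear only on members of the
   space. *)
suff h : forall r : seq I, car (fun y => \sum_(p <- r) c p * k y (z p)) /\
    ip g (fun y => \sum_(p <- r) c p * k y (z p)) = \sum_(p <- r) c p * g (z p).
  by have [] := h (index_enum I).
elim=> [|i r [IHc IHe]].
  rewrite (_ : (fun _ => _) = (fun=> 0)); last by apply/funext => y; rewrite big_nil.
  by rewrite hsym// ip0 big_nil.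
rewrite (_ : (fun _ => _) = (fun y => c i * k y (z i) + \sum_(p <- r) c p * k y (z p))).
  split; first exact: hlin.
  rewrite hsym//; last exact: hlin.
  by rewrite hiplin// hsym// hrepr// hsym// IHe big_cons.
by apply/funext => y; rewrite big_cons.
Qed.

Lemma ns_ip_ge0 f : ns_car H f -> 0 <= ns_ip H f f.
Proof.
case: H => car ip h0 hlin hsym hiplin hpos _ hk hrepr /= cf.
have [f0|/existsNP[x /eqP fx]] := pselect (forall x, f x = 0); last first.
  by apply/ltW/hpos => //; exists x.
have -> : f = (fun=> 0) by apply/funext.
have z0 : (fun=> 0) = (fun y : T => -1 * (fun=> 0 : R) y + (fun=> 0) y).
  by apply/funext => y; rewrite mulr0 addr0.
by rewrite [X in ip X _]z0 hiplin// mulN1r addNr.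
Qed.

Lemma ns_ip_eq0 f : ns_car H f -> ns_ip H f f = 0 -> forall x, f x = 0.
Proof.
case: H => car ip h0 hlin hsym hiplin hpos _ hk hrepr /= cf f0 x.
apply/eqP/negPn/negP => fx.
by have := hpos _ cf (ex_intro (fun y => f y != 0) x fx); rewrite f0 ltxx.
Qed.

(** [None] indexes the evaluation point and [Some i] the nodes, so that with [residual_coef] a
    residual becomes a single kernel combination of [N + 1] terms. *)
Definition cons_pt N (X : 'I_N -> T) (x : T) (p : option 'I_N) : T :=
  if p is Some i then X i else x.

Definition residual_coef N (c : 'I_N -> R) (p : option 'I_N) : R :=
  if p is Some i then - c i else 1.

Lemma big_option (V : zmodType) N (F : option 'I_N -> V) :
  \sum_p F p = F None + \sum_(i < N) F (Some i).
Proof.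
rewrite (bigD1 None)//=; congr (_ + _).
rewrite (reindex_omap Some id)/=; first by apply: eq_bigl => i; rewrite eqxx.
by case.
Qed.

Lemma residualE N (X : 'I_N -> T) x c :
  (k^~ x \- (fun y => \sum_(i < N) c i * k y (X i))) =
  kcomb (residual_coef c) (cons_pt X x).
Proof.
apply/funext => y; rewrite /kcomb big_option /= mul1r; congr (_ + _).
by rewrite -sumrN; apply: eq_bigr => i _; rewrite mulNr.
Qed.

(** Fredholm alternative for the Gram matrix, singular or not: a vector [w] that it annihilates
    gives a combination [kcomb w X] of norm 0, which therefore vanishes at [x]; hence [w]
    annihilates the right-hand side too. *)
Lemma interpolation_solvable N (X : 'I_N -> T) x :
  exists c : 'I_N -> R, forall j, \sum_(i < N) c i * k (X j) (X i) = k (X j) x.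
Proof.
pose G : 'M[R]_N := \matrix_(i, j) k (X i) (X j).
pose b : 'rV[R]_N := \row_j k (X j) x.
have bG : (b <= G)%MS.
  rewrite submxE; apply/eqP/rowP => j; rewrite [RHS]mxE.
  pose w i := cokermx G i j.
  have Gw i : \sum_l k (X i) (X l) * w l = 0.
    have /matrixP/(_ i j) := mulmx_coker G; rewrite mxE [RHS]mxE => e; rewrite -[RHS]e.
    by apply: eq_bigr => l _; rewrite mxE.
  have f0 : ns_ip H (kcomb w X) (kcomb w X) = 0.
    rewrite ns_ip_kcomb; last exact: kcomb_car.
    apply: big1 => i _; rewrite /kcomb (_ : \sum_p _ = 0) ?mulr0//.
    by rewrite -[RHS](Gw i); apply: eq_bigr => l _; rewrite mulrC.
  rewrite -[RHS](ns_ip_eq0 (kcomb_car w X) f0 x) /kcomb.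
  by rewrite mxE; apply: eq_bigr => i _; rewrite mxE k_sym mulrC.
have [D bE] := submxP bG.
exists (fun i => D ord0 i) => j.
have /rowP/(_ j) := bE; rewrite !mxE => ->.
by apply: eq_bigr => i _; rewrite mxE k_sym.
Qed.

Lemma power_function_sqr N (X : 'I_N -> T) x : exists c : 'I_N -> R,
  power_function H X x ^+ 2 =
  \sum_p \sum_q residual_coef c p * residual_coef c q *
    k (cons_pt X x p) (cons_pt X x q).
Proof.
pose V := @kernel_span R T k N X.
have [[c pE] _] : V (orthogonal_projection H V (k^~ x)) /\
    forall v, V v -> ns_ip H (k^~ x \- orthogonal_projection H V (k^~ x)) v = 0.
  (* [get] returns a projection only if one exists. The interpolation system supplies one, its
     equations being orthogonality to the kernel translates at the nodes. *)
  apply: (@getPex _ [set p | V p /\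
    forall v, V v -> ns_ip H (k^~ x \- p) v = 0]).
  have [c hc] := interpolation_solvable X x.
  exists (fun y => \sum_(i < N) c i * k y (X i)); split; first by exists c.
  move=> v [b ->]; rewrite residualE -/(kcomb b X) ns_ip_kcomb; last exact: kcomb_car.
  by apply: big1 => j _; rewrite -residualE /= hc subrr mulr0.
exists c.
rewrite /power_function /ns_norm -/V pE residualE.
rewrite sqr_sqrtr; last exact: ns_ip_ge0 (kcomb_car _ _).
rewrite ns_ip_kcomb; last exact: kcomb_car.
apply: eq_bigr => p _; rewrite /kcomb mulr_sumr; apply: eq_bigr => q _.
by rewrite mulrA.
Qed.

End power_function_form.

(** * Integration over R^d *)

Lemma integrable_mulb d (T : measurableType d) (R : realType)
    (m : {measure set T -> \bar R}) (f h : T -> R) :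
  m.-integrable setT (EFin \o f) -> measurable_fun setT h ->
  (forall x, `|h x| <= 1) -> m.-integrable setT (EFin \o (fun x => f x * h x)).
Proof.
move=> intf mh h1; apply: (le_integrable _ _ _ intf) => //.
  apply/measurable_EFinP/measurable_funM => //.
  by move/measurable_int/measurable_EFinP : intf.
by move=> x _; rewrite lee_fin normrM ler_piMr.
Qed.

Lemma integrable_cosM (R : realType) (f : R -> R) (a : R) :
  (@lebesgue_measure R).-integrable setT (EFin \o f) ->
  (@lebesgue_measure R).-integrable setT (EFin \o (fun x => f x * cos (x * a))).
Proof.
move=> intf; apply: (integrable_mulb intf); last by move=> x; exact: cos_max.
suff : continuous (fun x : R => cos (x * a)) by exact: continuous_measurable_fun.
move=> x; apply: (@continuous_comp _ _ _ (fun x : R => x * a) cos).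
  exact: mulrr_continuous.
exact: continuous_cos.
Qed.

Lemma integrable_sinM (R : realType) (f : R -> R) (a : R) :
  (@lebesgue_measure R).-integrable setT (EFin \o f) ->
  (@lebesgue_measure R).-integrable setT (EFin \o (fun x => f x * sin (x * a))).
Proof.
move=> intf; apply: (integrable_mulb intf); last by move=> x; exact: sin_max.
suff : continuous (fun x : R => sin (x * a)) by exact: continuous_measurable_fun.
move=> x; apply: (@continuous_comp _ _ _ (fun x : R => x * a) sin).
  exact: mulrr_continuous.
exact: continuous_sin.
Qed.

(** * Sigma-finiteness of Lebesgue measure on tuples *)

Section lebesgue_tuple_theory.
Context {R : realType}.
Local Notation mu := (@lebesgue_measure R).
Local Notation RR := (measurableTypeR R).

Definition tuple_box (k : R) n : set (n.-tuple RR) :=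
  [set t | forall i, `[- k, k]%classic (tnth t i)].

Lemma measurable_tuple_box (k : R) n : measurable (@tuple_box k n).
Proof.
rewrite (_ : @tuple_box k n =
  \bigcap_(i in [set: 'I_n]) ((fun t => tnth t i) @^-1` `[- k, k]%classic)).
  apply: fin_bigcap_measurable; first exact: finite_finset.
  move=> i _; rewrite -[X in measurable X]setTI.
  exact: (measurable_tnth i).
by apply/seteqP; split => t //= h i; [move=> _|]; exact: h.
Qed.

Lemma lebesgue_tuple_boxS (k : R) n :
  @lebesgue_tuple R n.+1 (@tuple_box k n.+1) =
  (mu `[(- k)%R, k]%classic * @lebesgue_tuple R n (@tuple_box k n))%E.
Proof.
rewrite -product_measure2E//; last exact: measurable_tuple_box.
rewrite /=/pushforward; congr (product_measure2 _ _ _).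
apply/seteqP; split => [[x t] /= h|[x t] /= [hx ht] i].
  split; first exact: (h ord0).
  by move=> i; have := h (lift ord0 i); rewrite tnthS.
by case: (unliftP ord0 i) => [j|] ->; rewrite ?tnthS//.
Qed.

Lemma lebesgue_tuple_sigma_finite n :
  sigma_finite [set: n.-tuple RR] (@lebesgue_tuple R n).
Proof.
exists (fun k => @tuple_box k%:R n).
  apply/esym/seteqP; split => // t _.
  pose M := \sum_(i < n) `|tnth t i|.
  exists (Num.bound M) => //= i; rewrite /= in_itv/= -ler_norml.
  have : `|tnth t i| <= M by rewrite /M (bigD1 i)//= lerDl sumr_ge0.
  move=> /le_trans; apply; apply/ltW/archi_boundP.
  exact: sumr_ge0.
move=> k; split; first exact: measurable_tuple_box.
elim: n => [|n IH].
  by rewrite /= diracE ltry.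
rewrite lebesgue_tuple_boxS; apply: lte_mul_pinfty => //.
rewrite lebesgue_measure_itv/=; by case: ifP.
Qed.

End lebesgue_tuple_theory.

(** * Fubini for products of functions of separate variables *)

Section integrable_prod.
Context d1 d2 (T1 : measurableType d1) (T2 : measurableType d2) (R : realType).
Variables (m1 : {sigma_finite_measure set T1 -> \bar R})
  (m2 : {sigma_finite_measure set T2 -> \bar R}).
Variables (f : T1 -> R) (g : T2 -> R).
Hypotheses (intf : m1.-integrable setT (EFin \o f))
  (intg : m2.-integrable setT (EFin \o g)).

Local Open Scope ereal_scope.
Let F (p : T1 * T2) := (f p.1 * g p.2)%R%:E.

Let mF : measurable_fun [set: (T1 * T2)%type] F.
Proof.
apply/measurable_EFinP/measurable_funM; apply: measurableT_comp => //.
- by move/measurable_int/measurable_EFinP : intf.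
- by move/measurable_int/measurable_EFinP : intg.
Qed.

Lemma integrable_prodM : (m1 \x m2)%E.-integrable setT F.
Proof.
have absg : \int[m2]_y `|(g y)%:E| = (\int[m2]_y `|g y|)%R%:E.
  by rewrite /Rintegral fineK//; apply: integrable_fin_num => //; exact: integrable_norm.
apply/(integrable12ltyP m1 m2 mF) => /=.
under eq_integral => x _.
  under eq_integral => y _ do rewrite /F/= normrM EFinM.
  rewrite integralZl//; last exact: integrable_norm.
  rewrite absg.
  over.
rewrite /= integralZr//; last exact: integrable_norm.
rewrite -ge0_fin_numE; last first.
  by rewrite mule_ge0// ?integral_ge0// lee_fin Rintegral_ge0.
by apply: fin_numM => //; apply: integrable_fin_num => //; exact: integrable_norm.
Qed.

(** [lebesgue_tuple] is built from [\x^], whereas the Tonelli criterion is applied for [\x]; they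
    agree by uniqueness of the product measure. *)
Let prod_measure21 A : measurable A -> (m1 \x m2)%E A = (m1 \x^ m2)%E A.
Proof.
by move=> mA; apply: product_measure_unique => // B C mB mC/=; rewrite product_measure2E.
Qed.

Lemma integrable_prod2M : (m1 \x^ m2)%E.-integrable setT F.
Proof.
have /integrableP[_ foo] := integrable_prodM.
apply/integrableP; split => //; move: foo.
rewrite (@eq_measure_integral _ _ _ _ (m1 \x^ m2)%E)// => A mA _.
exact: prod_measure21.
Qed.

Lemma integral_prod2M : \int[m1 \x^ m2]_p F p =
  ((\int[m1]_x f x)%R * (\int[m2]_y g y)%R)%:E.
Proof.
rewrite -(integral12_prod_meas2 integrable_prodM) /fubini_F/= /F/=.
under eq_integral => x _.
  under eq_integral => y _ do rewrite EFinM.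
  rewrite integralZl//.
  over.
have -> : \int[m2]_y (g y)%:E = (\int[m2]_y g y)%R%:E.
  by rewrite /Rintegral fineK//; exact: integrable_fin_num.
rewrite /= integralZr// EFinM; congr (_ * _).
by rewrite /Rintegral fineK//; exact: integrable_fin_num.
Qed.

End integrable_prod.

(** * Integrals of product functions over tuples *)

Section lebesgue_tuple_integral.
Context {R : realType}.
Local Notation mu := (@lebesgue_measure R).
Local Notation RR := (measurableTypeR R).

(** An alias to which the sigma-finiteness instance required by Fubini can be attached. *)
Let ltuple n : set (n.-tuple RR) -> \bar R := lebesgue_tuple n.

HB.instance Definition _ n := isMeasure.Build _ _ _ (@ltuple n)
  (measure0 (lebesgue_tuple n)) (measure_ge0 (lebesgue_tuple n))
  (@measure_semi_sigma_additive _ _ _ (lebesgue_tuple n)).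

HB.instance Definition _ n := Measure_isSigmaFinite.Build _ _ _
  (@ltuple n) (lebesgue_tuple_sigma_finite n).

Section tupleS.
Variables (n : nat) (f : RR -> R) (g : n.-tuple RR -> R).
Hypotheses (intf : mu.-integrable setT (EFin \o f))
  (intg : (@lebesgue_tuple R n).-integrable setT (EFin \o g)).

Let h (t : n.+1.-tuple RR) := f (thead t) * g [tuple of behead t].

Let mh : measurable_fun setT (EFin \o h).
Proof.
apply/measurable_EFinP/measurable_funM.
  apply: measurableT_comp; first by move/measurable_int/measurable_EFinP : intf.
  exact: (measurable_tnth ord0).
apply: measurableT_comp; first by move/measurable_int/measurable_EFinP : intg.
exact: measurable_behead.
Qed.

Let hE (p : RR * n.-tuple RR) : h (cons_pair p) = f p.1 * g p.2.
Proof.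
by rewrite /h/=; congr (_ * g _); apply: val_inj.
Qed.

Let intF : (mu \x^ @ltuple n)%E.-integrable (@cons_pair R n @^-1` setT)
  ((EFin \o h) \o @cons_pair R n).
Proof.
rewrite preimage_setT.
apply: eq_integrable (@integrable_prod2M _ _ _ _ _ _ (@ltuple n) _ _ intf intg) => // p _ /=.
by rewrite hE.
Qed.

Lemma integrable_lebesgue_tupleS : (@lebesgue_tuple R n.+1).-integrable setT (EFin \o h).
Proof.
exact: (@integrable_pushforward _ _ _ _ _ _ (@measurable_cons_pair R n)
  [the measure _ _ of (mu \x^ @ltuple n)%E] setT _ mh).
Qed.

Lemma integral_lebesgue_tupleS : \int[@lebesgue_tuple R n.+1]_t h t =
  (\int[mu]_x f x) * (\int[@lebesgue_tuple R n]_t g t).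
Proof.
rewrite /Rintegral/=.
rewrite (@integral_pushforward _ _ _ _ _ _ (@measurable_cons_pair R n)
  [the measure _ _ of (mu \x^ @ltuple n)%E] setT _ mh)//.
rewrite preimage_setT -[RHS]/(fine (_%:E)).
rewrite -(@integral_prod2M _ _ _ _ _ _ (@ltuple n) _ _ intf intg).
by congr fine; apply: eq_integral => p _ /=; rewrite hE.
Qed.

End tupleS.

Let lebesgue_tuple0E : @lebesgue_tuple R 0 = [the measure _ _ of \d_[tuple]].
Proof. by []. Qed.

Lemma integrable_tuple0 (c : R) :
  (@lebesgue_tuple R 0).-integrable setT (EFin \o cst c).
Proof.
apply/integrableP; split; first exact/measurable_EFinP.
by rewrite lebesgue_tuple0E integral_dirac//= diracT mul1e ltry.
Qed.

Lemma integral_tuple0 (g : 0.-tuple RR -> R) : measurable_fun setT g ->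
  \int[@lebesgue_tuple R 0]_t g t = g [tuple].
Proof.
move=> mg; rewrite /Rintegral lebesgue_tuple0E integral_dirac ?diracT ?mul1e//.
exact/measurable_EFinP.
Qed.

Let tnth_lift0 n (t : n.+1.-tuple RR) (i : 'I_n) :
  tnth t (lift ord0 i) = tnth [tuple of behead t] i.
Proof. by rewrite !(tnth_nth 0)/= nth_behead. Qed.

Lemma lebesgue_tuple_prod n (f : 'I_n -> R -> R) :
  (forall i, mu.-integrable setT (EFin \o f i)) ->
  (@lebesgue_tuple R n).-integrable setT
    (EFin \o (fun t => \prod_(i < n) f i (tnth t i))) /\
  \int[@lebesgue_tuple R n]_t (\prod_(i < n) f i (tnth t i)) =
  \prod_(i < n) \int[mu]_x f i x.
Proof.
elim: n f => [|n IH] f intf.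
  under [X in EFin \o X]eq_fun do rewrite big_ord0.
  under eq_Rintegral do rewrite big_ord0.
  by split; [exact: integrable_tuple0|rewrite integral_tuple0 ?big_ord0].
have [intg intgE] := IH (fun i => f (lift ord0 i)) (fun i => intf _).
have tE (t : n.+1.-tuple RR) : \prod_(i < n.+1) f i (tnth t i) =
    f ord0 (thead t) * \prod_(i < n) f (lift ord0 i) (tnth [tuple of behead t] i).
  by rewrite big_ord_recl; congr (_ * _); apply: eq_bigr => i _; rewrite tnth_lift0.
under [X in EFin \o X]eq_fun do rewrite tE.
under eq_Rintegral do rewrite tE.
split; first exact: (integrable_lebesgue_tupleS (intf ord0) intg).
by rewrite (integral_lebesgue_tupleS (intf ord0) intg) big_ord_recl intgE.
Qed.

(** Induction on the dimension with the addition formulas. Cosine and sine integrals go together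
    because [cos (a + b)] involves both; every term with a sine factor integrates to 0. *)
Lemma lebesgue_tuple_fourier n (f : R -> R) (w : 'I_n -> R) (a : 'I_n -> R) :
  mu.-integrable setT (EFin \o f) ->
  (forall i, \int[mu]_x (f x * cos (x * w i)) = a i) ->
  (forall i, \int[mu]_x (f x * sin (x * w i)) = 0) ->
  let F t := \prod_(i < n) f (tnth t i) in
  let theta t := \sum_(i < n) tnth t i * w i in
  [/\ (@lebesgue_tuple R n).-integrable setT (EFin \o (fun t => F t * cos (theta t))),
      (@lebesgue_tuple R n).-integrable setT (EFin \o (fun t => F t * sin (theta t))),
      \int[@lebesgue_tuple R n]_t (F t * cos (theta t)) = \prod_(i < n) a i &
      \int[@lebesgue_tuple R n]_t (F t * sin (theta t)) = 0].
Proof.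
move=> intf; elim: n w a => [|n IH] w a fc fs F theta.
  have -> : (fun t => F t * cos (theta t)) = cst 1.
    by apply/funext => t; rewrite /F /theta !big_ord0 cos0 mulr1.
  have -> : (fun t => F t * sin (theta t)) = cst 0.
    by apply/funext => t; rewrite /F /theta !big_ord0 sin0 mulr0.
  by split; [exact: integrable_tuple0..|rewrite integral_tuple0 ?big_ord0
    |rewrite integral_tuple0].
have [igc igs iC iS] := IH (fun i => w (lift ord0 i)) (fun i => a (lift ord0 i))
  (fun i => fc _) (fun i => fs _).
pose b (t : n.+1.-tuple RR) := [tuple of behead t].
pose G t := \prod_(i < n) f (tnth t i).
pose th t := \sum_(i < n) tnth t i * w (lift ord0 i).
rewrite -/G -/th in igc igs iC iS.
pose fc0 x := f x * cos (x * w ord0).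
pose fs0 x := f x * sin (x * w ord0).
have intc : mu.-integrable setT (EFin \o fc0).
  exact: integrable_cosM.
have ints : mu.-integrable setT (EFin \o fs0).
  exact: integrable_sinM.
have FE t : F t = f (thead t) * G (b t).
  by rewrite /F big_ord_recl; congr (_ * _); apply: eq_bigr => i _; rewrite tnth_lift0.
have thE t : theta t = thead t * w ord0 + th (b t).
  by rewrite /theta big_ord_recl; congr (_ + _); apply: eq_bigr => i _; rewrite tnth_lift0.
have -> : (fun t => F t * cos (theta t)) = (fun t =>
    fc0 (thead t) * (G (b t) * cos (th (b t))) -
    fs0 (thead t) * (G (b t) * sin (th (b t)))).
  by apply/funext => t; rewrite FE thE cosD /fc0 /fs0; ring.
have -> : (fun t => F t * sin (theta t)) = (fun t =>
    fs0 (thead t) * (G (b t) * cos (th (b t))) +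
    fc0 (thead t) * (G (b t) * sin (th (b t)))).
  by apply/funext => t; rewrite FE thE sinD /fc0 /fs0; ring.
have Icc := integrable_lebesgue_tupleS intc igc.
have Iss := integrable_lebesgue_tupleS ints igs.
have Ics := integrable_lebesgue_tupleS intc igs.
have Isc := integrable_lebesgue_tupleS ints igc.
have Ecc := integral_lebesgue_tupleS intc igc.
have Ess := integral_lebesgue_tupleS ints igs.
have Ecs := integral_lebesgue_tupleS intc igs.
have Esc := integral_lebesgue_tupleS ints igc.
split.
- exact: (integrableB _ Icc Iss).
- exact: (integrableD _ Isc Ics).
- by rewrite RintegralB// Ecc Ess iC iS mulr0 subr0 fc big_ord_recl.
- by rewrite RintegralD// Ecs Esc iC iS fs mul0r mulr0 add0r.
Qed.

End lebesgue_tuple_integral.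

(** * Fourier transforms of Gaussians *)

Section gauss1.
Context {R : realType}.
Local Notation mu := (@lebesgue_measure R).

(** The fundamental theorem of calculus on growing symmetric intervals, passed to the limit by
    dominated convergence; it serves as integration by parts with vanishing boundary terms. *)
Lemma integral_derive_eq0 (H h : R -> R) :
  (forall x, is_derive x (1 : R) H (h x)) -> continuous h ->
  mu.-integrable setT (EFin \o h) ->
  H n%:R - H (- n%:R) @[n --> \oo] --> 0 ->
  \int[mu]_x h x = 0.
Proof.
move=> dH ch ih H0.
(* The index is shifted by one to keep every interval nondegenerate. *)
pose A (n : nat) : set R := `[- n.+1%:R, n.+1%:R]%classic.
have cH : continuous H.
  by move=> x; apply: differentiable_continuous; apply/derivable1_diffP; have [] := dH x.
have AE n : (\int[mu]_(x in A n) (h x)%:E = (H n.+1%:R - H (- n.+1%:R))%:E)%E.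
  rewrite (@continuous_FTC2 _ _ H) ?EFinB//.
  - by rewrite gtrN.
  - exact: continuous_subspaceT.
  - split; first by move=> x _; have [] := dH x.
      by apply: cvg_at_right_filter; exact: cH.
    by apply: cvg_at_left_filter; exact: cH.
  - by move=> x _; rewrite derive1E; have [] := dH x.
have [|||||_ _] := @dominated_convergence _ _ _ mu setT measurableT
  (fun n => (EFin \o h) \_ (A n)) (EFin \o h) (abse \o (EFin \o h)).
- move=> n; apply: (measurable_restrictT _ (measurable_itv _)).1.
  exact: measurable_funTS (measurable_int _ ih).
- exact: measurable_int ih.
- apply: aeW => x _; apply: cvg_near_cst; near=> n.
  rewrite patchE mem_set// /A /= in_itv/= -ler_norml.
  apply: (@le_trans _ _ n%:R); last by rewrite ler_nat.
  near: n; exact: nbhs_infty_ger.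
- exact: integrable_abse.
- by apply: aeW => x n _; rewrite patchE; case: ifP => _; rewrite ?abse0 ?abse_ge0.
rewrite (_ : [sequence _]_n = EFin \o (fun n => H n.+1%:R - H (- n.+1%:R))); last first.
  by apply/funext => n /=; rewrite -AE -integral_mkcond.
move=> c1; have c0 : (EFin \o (fun n => H n.+1%:R - H (- n.+1%:R))) n @[n --> \oo] --> 0%:E.
  apply: cvg_EFin; first exact: nearW.
  by move: H0; rewrite -(cvg_shiftS (fun n => H n%:R - H (- n%:R))).
by rewrite /Rintegral (cvg_unique _ c1 c0).
Unshelve. all: by end_near. Qed.

Definition gauss1 (s x : R) : R := expR (- (s * x ^+ 2)).

(** Standard deviation of the normal density proportional to [gauss1 s], whose mass and
    integrability are inherited from that density. *)
Let sigma s := Num.sqrt (2 * s)^-1 : R.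

Let gauss1_normal s m : 0 < s ->
  (fun x => gauss1 s (x - m)) =
  (fun x => Num.sqrt (pi / s) * normal_pdf m (sigma s) x).
Proof.
move=> s0; apply/funext => x.
have sg0 : sigma s != 0 by rewrite gt_eqF// sqrtr_gt0 invr_gt0 mulr_gt0.
have sg2 : sigma s ^+ 2 = (2 * s)^-1 by rewrite sqr_sqrtr// invr_ge0 mulr_ge0// ltW.
rewrite normal_pdfE// /normal_peak/normal_fun sg2.
rewrite (_ : (2 * s)^-1 * pi *+ 2 = pi / s); last by rewrite -mulr_natr; field; rewrite gt_eqF.
rewrite mulrA divff ?mul1r; last by rewrite gt_eqF// sqrtr_gt0 divr_gt0// pi_gt0.
by congr expR; rewrite -mulr_natr; field; rewrite gt_eqF.
Qed.

Lemma integrable_gauss1B s m : 0 < s ->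
  mu.-integrable setT (EFin \o (fun x => gauss1 s (x - m))).
Proof.
move=> s0; rewrite gauss1_normal//.
have := integrableZl measurableT (Num.sqrt (pi / s)) (integrable_normal_pdf m (sigma s)).
exact.
Qed.

Lemma integral_gauss1B s m : 0 < s ->
  \int[mu]_x gauss1 s (x - m) = Num.sqrt (pi / s).
Proof.
move=> s0; rewrite gauss1_normal// RintegralZl//; last exact: integrable_normal_pdf.
by rewrite /Rintegral integral_normal_pdf mulr1.
Qed.

Lemma integrable_gauss1 s : 0 < s -> mu.-integrable setT (EFin \o gauss1 s).
Proof.
by move/(integrable_gauss1B 0); apply: eq_integrable => // x _ /=; rewrite subr0.
Qed.

Lemma integral_gauss1 s : 0 < s -> \int[mu]_x gauss1 s x = Num.sqrt (pi / s).
Proof.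
move=> s0; rewrite -(integral_gauss1B 0 s0).
by apply: eq_Rintegral => x _; rewrite subr0.
Qed.

(** Half of the exponent is spent on [|x|], through [1 + u <= expR u]; the other half remains as an
    integrable majorant. *)
Lemma normM_gauss1_le s x : 0 < s ->
  `|x| * gauss1 s x <= (1 + 2 / s) * gauss1 (s / 2) x.
Proof.
move=> s0; have -> : gauss1 s x = gauss1 (s / 2) x * gauss1 (s / 2) x.
  by rewrite /gauss1 -expRD; congr expR; field.
rewrite mulrA ler_wpM2r ?expR_ge0//.
rewrite /gauss1 expRN ler_pdivrMr ?expR_gt0//.
apply: (@le_trans _ _ ((1 + 2 / s) * (1 + s / 2 * x ^+ 2))); last first.
  by rewrite ler_wpM2l ?expR_ge1Dx// addr_ge0// divr_ge0// ltW.
have -> : (1 + 2 / s) * (1 + s / 2 * x ^+ 2) = 1 + x ^+ 2 + (2 / s + s / 2 * x ^+ 2).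
  by field; rewrite gt_eqF.
have : 0 <= 2 / s + s / 2 * x ^+ 2.
  by rewrite addr_ge0 ?divr_ge0 ?(ltW s0)// mulr_ge0 ?sqr_ge0// divr_ge0 ?(ltW s0).
by rewrite -(real_normK (num_real x)); have := sqr_ge0 (`|x| - 1); nra.
Qed.

Lemma continuous_gauss1 s : continuous (gauss1 s).
Proof.
move=> x; apply: (cvg_comp _ expR); last exact: continuous_expR.
apply: (@cvgN _ R^o); apply: cvgM; first exact: cvg_cst.
exact: exprn_continuous.
Qed.

Lemma measurable_gauss1 s : measurable_fun setT (gauss1 s).
Proof. exact: continuous_measurable_fun (@continuous_gauss1 s). Qed.

Lemma integrable_Mgauss1 s : 0 < s ->
  mu.-integrable setT (EFin \o (fun x => x * gauss1 s x)).
Proof.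
move=> s0.
have := integrableZl measurableT (1 + 2 / s) (integrable_gauss1 (divr_gt0 s0 (@ltr0n R 2))).
apply: le_integrable => //.
  apply/measurable_EFinP/measurable_funM => //; exact: measurable_gauss1.
move=> x _; rewrite lee_fin !normrM !(ger0_norm (expR_ge0 _)).
have K0 : 0 <= 1 + 2 / s by rewrite addr_ge0// divr_ge0// ltW.
by rewrite (ger0_norm K0); exact: normM_gauss1_le.
Qed.

Section phase.
Variables (s : R) (s0 : 0 < s) (c : R).

Let f (w y : R) := gauss1 s y * cos (y * w + c).
Let J (w : R) := \int[mu]_y f w y.

Let measurable_cosMD (w : R) : measurable_fun setT (fun y : R => cos (y * w + c)).
Proof.
suff : continuous (fun y : R => cos (y * w + c)) by exact: continuous_measurable_fun.
move=> y; apply: (cvg_comp _ cos); last exact: continuous_cos.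
by apply: (@cvgD _ R^o); [exact: mulrr_continuous|exact: cvg_cst].
Qed.

Let measurable_sinMD (w : R) : measurable_fun setT (fun y : R => sin (y * w + c)).
Proof.
suff : continuous (fun y : R => sin (y * w + c)) by exact: continuous_measurable_fun.
move=> y; apply: (cvg_comp _ sin); last exact: continuous_sin.
by apply: (@cvgD _ R^o); [exact: mulrr_continuous|exact: cvg_cst].
Qed.

Let if_ w : mu.-integrable setT (EFin \o f w).
Proof.
apply: (integrable_mulb (integrable_gauss1 s0)); first exact: measurable_cosMD.
by move=> y; exact: cos_max.
Qed.

Let iyf w : mu.-integrable setT (EFin \o (fun y => y * gauss1 s y * sin (y * w + c))).
Proof.
apply: (integrable_mulb (integrable_Mgauss1 s0)); first exact: measurable_sinMD.
by move=> y; exact: sin_max.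
Qed.

Let df w y : is_derive w (1 : R) (f ^~ y) (- (y * gauss1 s y * sin (y * w + c))).
Proof.
rewrite /f; apply: trigger_derive.
rewrite /GRing.scale/=; ring.
Qed.

Let dH w y : is_derive y (1 : R) (fun y => gauss1 s y * sin (y * w + c))
  (w * f w y - 2 * s * (y * gauss1 s y * sin (y * w + c))).
Proof.
rewrite /f /gauss1; apply: trigger_derive.
rewrite /GRing.scale/=; ring.
Qed.

(** Integration by parts: the derivative in [y] of [gauss1 s y * sin (y * w + c)] has integral 0. *)
Let ibp w : \int[mu]_y (y * gauss1 s y * sin (y * w + c)) = w / (2 * s) * J w.
Proof.
have ih : mu.-integrable setT (EFin \o (fun y =>
    w * f w y - 2 * s * (y * gauss1 s y * sin (y * w + c)))).
  exact: (integrableB _ (integrableZl _ _ (if_ w)) (integrableZl _ _ (iyf w))).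
have := @integral_derive_eq0 (fun y => gauss1 s y * sin (y * w + c)) _ (dH w) _ ih.
rewrite RintegralB//; last 2 first.
  exact: (integrableZl _ _ (if_ w)).
  exact: (integrableZl _ _ (iyf w)).
rewrite !RintegralZl// -/(J w) => h.
suff : w * J w - 2 * s * \int[mu]_y (y * gauss1 s y * sin (y * w + c)) = 0.
  move/eqP; rewrite subr_eq0 => /eqP e.
  by rewrite mulrAC e; field; rewrite gt_eqF.
apply: h.
  move=> y; apply: differentiable_continuous; apply/derivable1_diffP.
  by rewrite /f /gauss1; exact: ex_derive.
apply: norm_cvg0.
(* At [y = n] and [y = - n] the boundary term is at most [expR (- s * n ^+ 2)], hence at most
   [expR (- s) ^+ n]. *)
have g0 : 2 * expR (- s) ^+ n @[n --> \oo] --> 0.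
  rewrite -(mulr0 2); apply: cvgM; first exact: cvg_cst.
  by apply: cvg_expr; rewrite ger0_norm ?expR_ge0// -expR0 ltr_expR oppr_lt0.
apply: (@squeeze_cvgr _ _ _ _ (cst 0) _ _ _ _ _ g0); last exact: cvg_cst.
apply: nearW => n; rewrite normr_ge0 /=.
have gn (y : R) : y ^+ 2 = n%:R ^+ 2 -> `|gauss1 s y * sin (y * w + c)| <= expR (- s) ^+ n.
  move=> yn; rewrite normrM (ger0_norm (expR_ge0 _)).
  apply: (@le_trans _ _ (gauss1 s y)); first by rewrite ler_piMr ?expR_ge0 ?sin_max.
  rewrite -expRM_natl ler_expR yn mulrN lerN2 mulrC ler_wpM2l ?(ltW s0)//.
  by rewrite -natrX ler_nat; case: (n) => // m; rewrite leq_pmulr.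
by rewrite (le_trans (ler_normB _ _))// mulr2n mulrDl mul1r lerD// gn// sqrrN.
Qed.

Let dJ w : is_derive w (1 : R) J (- (w / (2 * s)) * J w).
Proof.
have d1E x y : partial1of2 f x y = - (y * gauss1 s y * sin (y * x + c)).
  by have dd := df x y; rewrite partial1of2E derive_val.
have w_in : [set` `]w - 1, w + 1[] w by rewrite /= in_itv/= ltrDl ltrBlDr ltrDl !ltr01.
have intG := integrable_norm (integrable_Mgauss1 s0).
have G_ge0 y : 0 <= `|y * gauss1 s y| by exact: normr_ge0.
have derf1 x y : [set` `]w - 1, w + 1[] x -> [set: R] y -> derivable (f ^~ y) x 1.
  by move=> _ _; have [] := df x y.
have G_ub x y : [set` `]w - 1, w + 1[] x -> [set: R] y ->
    `|partial1of2 f x y| <= `|y * gauss1 s y|.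
  by move=> _ _; rewrite d1E normrN normrM ler_piMr// sin_max.
apply: DeriveDef.
  exact: (derivable_under_integral measurableT w_in
    (fun x _ => if_ x) derf1 G_ge0 intG G_ub).
rewrite -derive1E (differentiation_under_integral measurableT w_in
  (fun x _ => if_ x) derf1 G_ge0 intG G_ub)//.
under eq_Rintegral do rewrite d1E.
rewrite mulNr -ibp -[RHS]mulN1r -RintegralZl//.
by apply: eq_Rintegral => y _; rewrite mulN1r.
Qed.

(** By [dJ] the integral [J] solves a linear differential equation; its integrating factor makes [K]
    constant, and [K 0] is a plain Gaussian integral. The phase [c] covers the cosine integral at 0
    and the sine integral at [- (pi / 2)]. *)
Lemma integral_gauss1_cosD w :
  \int[mu]_y (gauss1 s y * cos (y * w + c)) =
  cos c * Num.sqrt (pi / s) * gauss1 (4 * s)^-1 w.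
Proof.
pose K x := J x * expR (x ^+ 2 / (4 * s)).
have K0 : K w = K 0.
  apply: is_derive_0_is_cst => x; rewrite /K.
  have dJx := dJ x.
  apply: trigger_derive.
  by rewrite /GRing.scale/=; field; rewrite gt_eqF.
have -> : \int[mu]_y (gauss1 s y * cos (y * w + c)) = K w * gauss1 (4 * s)^-1 w.
  rewrite /K /gauss1 -mulrA -expRD (_ : _ + _ = 0) ?expR0 ?mulr1//.
  by rewrite mulrC subrr.
rewrite K0 /K expr0n mul0r expR0 mulr1; congr (_ * _).
rewrite /J /f; under eq_Rintegral do rewrite mulr0 add0r.
rewrite (RintegralZr (cos c) measurableT (integrable_gauss1 s0)).
by rewrite integral_gauss1// mulrC.
Qed.

End phase.

Lemma integral_gauss1_cos s w : 0 < s ->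
  \int[mu]_x (gauss1 s x * cos (x * w)) = Num.sqrt (pi / s) * gauss1 (4 * s)^-1 w.
Proof.
move=> s0; have := integral_gauss1_cosD s0 0 w; rewrite cos0 mul1r => <-.
by under [RHS]eq_Rintegral do rewrite addr0.
Qed.

Lemma integral_gauss1_sin s w : 0 < s -> \int[mu]_x (gauss1 s x * sin (x * w)) = 0.
Proof.
move=> s0; have := integral_gauss1_cosD s0 (- (pi / 2)) w.
rewrite cosN cos_pihalf !mul0r => <-.
by apply: eq_Rintegral => x _; rewrite cosBpihalf.
Qed.

End gauss1.

(** * Transfer of integrals from tuples to row vectors *)

Section lebesgue_rV_integral.
Context {R : realType} {d : nat}.
Local Notation mu := (@lebesgue_measure R).
Local Notation rV := 'rV[R]_d.
Local Notation nu := (@lebesgue_rV R d).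

Lemma measurable_rV_coord (i : 'I_d) : measurable_fun setT (fun x : rV => x ord0 i).
Proof.
move=> _ Y mY; rewrite setTI; apply: sub_sigma_algebra => /=.
rewrite -bigcup_seq/=; exists i => /=; first by rewrite mem_index_enum.
by exists Y => //; rewrite setTI.
Qed.

Section transfer.
Variables (g : rV -> R) (mg : measurable_fun setT g).
Hypothesis intg : (@lebesgue_tuple R d).-integrable setT
  (EFin \o (fun t => g (rV_of_tuple t))).

Let mEg : measurable_fun setT (EFin \o g).
Proof. exact/measurable_EFinP. Qed.

Lemma integrable_rV_tuple : nu.-integrable setT (EFin \o g).
Proof.
exact: (@integrable_pushforward _ _ _ _ _ _ (@measurable_rV_of_tuple R d) _ setT _ mEg).
Qed.

Lemma integral_rV_tuple :
  \int[nu]_x g x = \int[@lebesgue_tuple R d]_t g (rV_of_tuple t).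
Proof.
rewrite /Rintegral.
rewrite (@integral_pushforward _ _ _ _ _ _ (@measurable_rV_of_tuple R d) _ setT _ mEg)//.
Qed.

End transfer.

Lemma lebesgue_rV_prod (f : 'I_d -> R -> R) :
  (forall i, mu.-integrable setT (EFin \o f i)) ->
  nu.-integrable setT (EFin \o (fun x : rV => \prod_(i < d) f i (x ord0 i))) /\
  \int[nu]_x (\prod_(i < d) f i (x ord0 i)) = \prod_(i < d) \int[mu]_x f i x.
Proof.
move=> intf; have [] := lebesgue_tuple_prod intf.
set g := fun x : rV => \prod_(i < d) f i (x ord0 i).
have gE : (fun t : d.-tuple (measurableTypeR R) => \prod_(i < d) f i (tnth t i)) =
    (fun t => g (rV_of_tuple t)).
  by apply/funext => t; apply: eq_bigr => i _; rewrite mxE.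
have mg : measurable_fun setT g.
  apply: measurable_prod => i _; apply: measurableT_comp.
    by have /measurable_int/measurable_EFinP := intf i.
  exact: measurable_rV_coord.
rewrite gE => ig <-; split; first exact: integrable_rV_tuple.
by rewrite integral_rV_tuple.
Qed.

Definition gauss (s : R) (x : rV) : R := expR (- (s * dotv x x)).

Lemma gaussE s x : gauss s x = \prod_(i < d) gauss1 s (x ord0 i).
Proof.
rewrite /gauss /dotv mulr_sumr -sumrN expR_sum.
by apply: eq_bigr => i _; rewrite /gauss1 expr2.
Qed.

Lemma measurable_dotv w : measurable_fun setT (fun x : rV => dotv x w).
Proof.
apply: measurable_sum => i; apply: measurable_funM => //.
exact: measurable_rV_coord.
Qed.

Lemma measurable_gauss s : measurable_fun setT (gauss s).
Proof.
rewrite (_ : gauss s = (fun x => \prod_(i < d) gauss1 s (x ord0 i))); last first.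
  by apply/funext => x; exact: gaussE.
apply: measurable_prod => i _; apply: measurableT_comp (measurable_rV_coord i).
by apply: measurableT_comp => //; apply: measurableT_comp => //; exact: measurable_funM.
Qed.

Lemma measurable_cos_dotv w : measurable_fun setT (fun x : rV => cos (dotv x w)).
Proof.
have mcos : measurable_fun [set: R] (@cos R).
  exact: continuous_measurable_fun (@continuous_cos R).
exact: measurableT_comp mcos (measurable_dotv w).
Qed.

Lemma integral_gauss_cos s w : 0 < s ->
  nu.-integrable setT (EFin \o (fun x => gauss s x * cos (dotv x w))) /\
  \int[nu]_x (gauss s x * cos (dotv x w)) =
  Num.sqrt (pi / s) ^+ d * gauss (4 * s)^-1 w.
Proof.
move=> s0.
have [igc _ iC _] := @lebesgue_tuple_fourier R d (gauss1 s) (fun i => w ord0 i) _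
  (integrable_gauss1 s0) (fun i => integral_gauss1_cos _ s0)
  (fun i => integral_gauss1_sin _ s0).
set g := fun x => gauss s x * cos (dotv x w).
have gE : (fun t : d.-tuple (measurableTypeR R) => \prod_(i < d) gauss1 s (tnth t i) *
    cos (\sum_(i < d) tnth t i * w ord0 i)) =
    (fun t => g (rV_of_tuple t)).
  apply/funext => t; rewrite /g gaussE; congr (_ * cos _).
    by apply: eq_bigr => i _; rewrite mxE.
  by apply: eq_bigr => i _; rewrite mxE.
have mg : measurable_fun setT g.
  apply: measurable_funM; first exact: measurable_gauss.
  exact: measurable_cos_dotv.
rewrite gE in igc.
split; first exact: integrable_rV_tuple.
rewrite integral_rV_tuple// -gE iC big_split/= gaussE prodr_const card_ord.
by [].
Qed.

Definition rV_box (x : rV) (a : R) : set rV :=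
  [set y | forall i, x ord0 i <= y ord0 i <= x ord0 i + a].

Lemma measurable_rV_box x a : measurable (rV_box x a).
Proof.
rewrite (_ : rV_box x a = \bigcap_(i in [set: 'I_d])
    ((fun y : rV => y ord0 i) @^-1` `[x ord0 i, x ord0 i + a]%classic)).
  apply: fin_bigcap_measurable; first exact: finite_finset.
  move=> i _; rewrite -[X in measurable X]setTI.
  exact: measurable_rV_coord.
apply/seteqP; split => y /= h i; first by rewrite /= in_itv/=.
by have := h i I; rewrite /= in_itv.
Qed.

(** The indicator of the box is a product of interval indicators, so its integral is a product of
    positive lengths, which a null box would force to be 0. *)
Lemma lebesgue_rV_box_gt0 x a : 0 < a -> (0 < nu (rV_box x a))%E.
Proof.
move=> a0; rewrite lt_def measure_ge0 andbT; apply/eqP => nu0.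
have [i|_] := @lebesgue_rV_prod (fun i => \1_`[x ord0 i, x ord0 i + a]%classic).
  exact: integrable_indic_itv.
have -> : (fun y : rV => \prod_(i < d) \1_`[x ord0 i, x ord0 i + a]%classic (y ord0 i)) =
    (\1_(rV_box x a) : rV -> R).
  apply/funext => y; rewrite [RHS]indicE; have [/set_mem yB|yB] := boolP (y \in rV_box x a).
    by apply: big1 => i _; rewrite indicE mem_set//= in_itv/= yB.
  apply/eqP; apply: contraNT yB; move/prodf_neq0 => h; apply/mem_set => i.
  have := h i isT; rewrite indicE; case: (boolP (_ \in _)) => [/set_mem|_].
    by rewrite /= in_itv.
  by rewrite eqxx.
rewrite /Rintegral integral_indic//; last exact: measurable_rV_box.
rewrite setIT nu0 /= => /esym/eqP; rewrite prodf_seq_eq0 => /hasP[i _].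
rewrite /= integral_indic//= setIT lebesgue_measure_itv/= lte_fin ltrDl a0.
by rewrite -EFinD addrAC subrr add0r/= gt_eqF.
Qed.

End lebesgue_rV_integral.

(** * Modulated Gaussians as test functions *)

Section schwartz_gauss.
Context {R : realType} {d : nat}.
Local Notation rV := 'rV[R]_d.
Implicit Types (x z : rV).

(** Reduces a directional derivative to one in a real variable, which [trigger_derive] can
    compute. *)
Lemma is_derive_line (f : rV -> R) x v df :
  is_derive (0 : R) (1 : R) (fun h : R => f (h *: v + x)) df -> is_derive x v f df.
Proof.
have E : (fun h : R => h^-1 *:
      (((fun h : R => f (h *: v + x)) \o shift 0) (h *: (1 : R)) - f (0 *: v + x)))
    = (fun h : R => h^-1 *: ((f \o shift x) (h *: v) - f x)).
  apply/funext => h /=; rewrite scale0r add0r addr0.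
  by rewrite [h *: 1]mulr1.
move=> [d0 <-].
split.
  by move: d0; rewrite /derivable E.
by rewrite /derive E.
Qed.

Lemma polyM_gauss_bounded (s : R) n : 0 < s ->
  exists M, forall r : R, 0 <= r -> (1 + r) ^+ n * expR (- (s * r ^+ 2)) <= M.
Proof.
(* [expR (s * r ^+ 2)] is split into [n + 1] equal factors [expR (t * r ^+ 2)], each of which
   dominates [1 + r] up to the constant [2 * K]. *)
move=> s0; pose t := s / n.+1%:R; pose K := 1 + t^-1.
have t0 : 0 < t by rewrite divr_gt0.
have K0 : 0 < K by rewrite addr_gt0// invr_gt0.
exists ((2 * K) ^+ n.+1) => r r0.
rewrite expRN ler_pdivrMr ?expR_gt0//.
have r1 : 1 <= 1 + r by rewrite lerDl.
apply: (@le_trans _ _ ((1 + r) ^+ n.+1)).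
  by rewrite exprS ler_peMl// exprn_ge0// addr_ge0.
have -> : s * r ^+ 2 = n.+1%:R * (t * r ^+ 2).
  by rewrite /t; field; rewrite addrC natr1 pnatr_eq0.
rewrite expRM_natl -exprMn lerXn2r ?nnegrE ?addr_ge0 ?mulr_ge0 ?expR_ge0 ?(ltW K0)//.
apply: (@le_trans _ _ (2 * (K * (1 + t * r ^+ 2)))); last first.
  by rewrite mulrA ler_wpM2l ?expR_ge1Dx// mulr_ge0// ltW.
have -> : K * (1 + t * r ^+ 2) = 1 + r ^+ 2 + (t^-1 + t * r ^+ 2).
  by rewrite /K; field; rewrite gt_eqF.
have : 0 <= t^-1 + t * r ^+ 2.
  by rewrite addr_ge0 ?invr_ge0 ?(ltW t0)// mulr_ge0 ?sqr_ge0 ?(ltW t0).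
by have := sqr_ge0 (r - 1); nra.
Qed.

Lemma continuous_rV_coord (i : 'I_d) : continuous (fun x : rV => x ord0 i).
Proof. exact: coord_continuous. Qed.

Let contM (f g : rV -> R) : continuous f -> continuous g ->
  continuous (fun x => f x * g x).
Proof. by move=> cf cg x; exact: cvgM (cf x) (cg x). Qed.

Let contD (f g : rV -> R) : continuous f -> continuous g ->
  continuous (fun x => f x + g x).
Proof. by move=> cf cg x; exact: (@cvgD _ R^o _ _ _ _ _ _ _ (cf x) (cg x)). Qed.

Let cont_cst (a : R) : continuous (fun _ : rV => a).
Proof. exact: cst_continuous. Qed.

Lemma continuous_dotv z : continuous (fun x : rV => dotv x z).
Proof.
apply: continuous_big => [|i _]; first exact: add_continuous.
by apply: contM; [exact: continuous_rV_coord|exact: cont_cst].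
Qed.

Lemma continuous_gauss s : continuous (@gauss R d s).
Proof.
have c : continuous (fun x : rV => dotv x x).
  apply: continuous_big => [|i _]; first exact: add_continuous.
  by apply: contM; exact: continuous_rV_coord.
rewrite (_ : @gauss R d s = expR \o (fun x => - s * dotv x x)).
  move=> x; apply: continuous_comp; last exact: continuous_expR.
  exact: contM (@cont_cst (- s)) c x.
by apply/funext => x; rewrite /gauss /= mulNr.
Qed.

Lemma dotvC x z : dotv x z = dotv z x.
Proof. by apply: eq_bigr => i _; rewrite mulrC. Qed.

Lemma dotvDl x y z : dotv (x + y) z = dotv x z + dotv y z.
Proof. by rewrite -big_split; apply: eq_bigr => i _; rewrite mxE mulrDl. Qed.

Lemma dotvZl a x z : dotv (a *: x) z = a * dotv x z.
Proof. by rewrite mulr_sumr; apply: eq_bigr => i _; rewrite mxE mulrA. Qed.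

Lemma dotv_delta (i : 'I_d) z : dotv (delta_mx ord0 i) z = z ord0 i.
Proof.
rewrite /dotv (bigD1 i)//= mxE !eqxx mul1r big1 ?addr0// => j /negPf ji.
by rewrite mxE ji andbF mul0r.
Qed.

Lemma dotv_ge0 x : 0 <= dotv x x.
Proof. by apply: sumr_ge0 => i _; rewrite -expr2 sqr_ge0. Qed.

Lemma enorm_sqr x : enorm x ^+ 2 = dotv x x.
Proof. by rewrite sqr_sqrtr// dotv_ge0. Qed.

Lemma coord_le_enorm x (i : 'I_d) : `|x ord0 i| <= enorm x.
Proof.
rewrite -sqrtr_sqr ler_wsqrtr// /dotv (bigD1 i)//= -expr2 lerDl.
by apply: sumr_ge0 => j _; rewrite -expr2 sqr_ge0.
Qed.

Variable s : R.
Hypothesis s0 : 0 < s.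

(* Closed under differentiation; the phase [c] makes sines superfluous. *)
Inductive gauss_class : (rV -> R) -> Prop :=
| gauss_class_base z c : gauss_class (fun x => gauss s x * cos (dotv x z + c))
| gauss_class_coordM i f : gauss_class f -> gauss_class (fun x => x ord0 i * f x)
| gauss_class_lin a f g : gauss_class f -> gauss_class g ->
    gauss_class (fun x => a * f x + g x).

Lemma gauss_class_continuous f : gauss_class f -> continuous f.
Proof.
elim=> [z c|i {}f _ cf|a {}f g _ cf _ cg].
- apply: contM; first exact: continuous_gauss.
  move=> x; apply: (@continuous_comp rV R R (fun x => dotv x z + c) cos).
    exact: (contD (@continuous_dotv z) (@cont_cst c)).
  exact: continuous_cos.
- exact: contM (@continuous_rV_coord i) cf.
- exact: contD (contM (@cont_cst a) cf) cg.
Qed.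

Lemma gauss_class_bounded f : gauss_class f ->
  forall n, exists M, forall x, (1 + enorm x) ^+ n * `|f x| <= M.
Proof.
elim=> [z c|i {}f _ bf|a {}f g _ bf _ bg] n.
- have [M hM] := polyM_gauss_bounded n s0; exists M => x.
  apply: le_trans (hM (enorm x) (sqrtr_ge0 _)).
  rewrite ler_wpM2l ?exprn_ge0 ?addr_ge0 ?sqrtr_ge0// enorm_sqr.
  by rewrite normrM (ger0_norm (expR_ge0 _)) ler_piMr ?expR_ge0 ?cos_max.
- have [M hM] := bf n.+1; exists M => x; apply: le_trans (hM x).
  rewrite normrM exprSr -mulrA ler_wpM2l ?exprn_ge0 ?addr_ge0 ?sqrtr_ge0//.
  by rewrite ler_wpM2r// (le_trans (coord_le_enorm x i))// lerDr.
- have [M hM] := bf n; have [N hN] := bg n; exists (`|a| * M + N) => x.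
  have e0 : 0 <= (1 + enorm x) ^+ n by rewrite exprn_ge0 ?addr_ge0 ?sqrtr_ge0.
  apply: (@le_trans _ _ ((1 + enorm x) ^+ n * (`|a| * `|f x| + `|g x|))).
    by rewrite ler_wpM2l// -normrM ler_normD.
  by rewrite mulrDr lerD// mulrCA ler_wpM2l.
Qed.

Lemma gauss_class_derive f i : gauss_class f ->
  exists2 g, gauss_class g & forall x, is_derive x (delta_mx ord0 i : rV) f (g x).
Proof.
elim=> [z c|j {}f gf [g gg dg]|a {}f1 f2 _ [g1 gg1 dg1] _ [g2 gg2 dg2]].
(* As [cos (u + pi / 2) = - sin u], differentiating the cosine only shifts its phase. The last
   summand [- 1 * f + f], with [f] the base function, is a zero that makes the expression fit the
   constructor for linear combinations. *)
- exists (fun x => (- 2 * s) * (x ord0 i * (gauss s x * cos (dotv x z + c))) +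
    (z ord0 i * (gauss s x * cos (dotv x z + (c + pi / 2))) +
     (- 1 * (gauss s x * cos (dotv x z + c)) + gauss s x * cos (dotv x z + c)))).
    by repeat constructor.
  move=> x; apply: is_derive_line.
  have -> : (fun h : R => gauss s (h *: delta_mx ord0 i + x) *
      cos (dotv (h *: delta_mx ord0 i + x) z + c)) =
      (fun h : R => expR (- (s * (h ^+ 2 + 2 * h * x ord0 i + dotv x x))) *
      cos (h * z ord0 i + dotv x z + c)).
    apply/funext => h; rewrite /gauss !dotvDl dotvZl !dotv_delta !mxE !eqxx/=.
    rewrite (dotvC x (_ + _)) dotvDl dotvZl dotv_delta.
    by rewrite dotvZl dotv_delta; congr (expR (- (s * _)) * _); ring.
  rewrite (addrA (dotv x z) c) cosDpihalf /gauss.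
  apply: trigger_derive.
  rewrite /GRing.scale/= expr0n/= !mulr0 !mul0r !add0r.
  by ring.
- exists (fun x => (i == j)%:R * f x + x ord0 j * g x).
    by constructor => //; constructor.
  move=> x; have := dg x => dgx.
  have dc : is_derive x (delta_mx ord0 i : rV) (fun x : rV => x ord0 j) (i == j)%:R.
    apply: is_derive_line.
    rewrite (_ : (fun _ => _) = (fun h : R => h * (i == j)%:R + x ord0 j)).
      by apply: trigger_derive; rewrite /GRing.scale/= !mulr0 mulr1 !addr0 add0r.
    by apply/funext => h; rewrite !mxE eqxx/= eq_sym.
  apply: (@is_derive_eq _ _ _ _ _ _ _ _ (is_deriveM dc dgx)).
  by rewrite /GRing.scale/= addrC mulrC.
- exists (fun x => a * g1 x + g2 x); first by constructor.
  move=> x; have := dg1 x => d1; have := dg2 x => d2.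
  exact: is_deriveD (is_deriveZ a d1) d2.
Qed.

Lemma gauss_class_partials f : gauss_class f ->
  forall t : seq 'I_d, gauss_class (partials t f).
Proof.
move=> gf; elim=> [//|i t IH] /=.
have [g gg dg] := gauss_class_derive i IH.
rewrite (_ : (fun x => _) = g)//; apply/funext => x.
by have := dg x => dgx; rewrite derive_val.
Qed.

Lemma gauss_class_schwartz f : gauss_class f -> schwartz f.
Proof.
move=> gf; split=> [t|n t]; have gt := gauss_class_partials gf t.
  split; first exact: gauss_class_continuous.
  by move=> i x; have [g _ dg] := gauss_class_derive i gt; have := dg x => -[].
exact: gauss_class_bounded.
Qed.

Lemma schwartz_gauss_cos z : schwartz (fun x => gauss s x * cos (dotv x z)).
Proof.
apply: gauss_class_schwartz.
rewrite (_ : (fun x => _) = (fun x => gauss s x * cos (dotv x z + 0))).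
  exact: gauss_class_base.
by apply/funext => x; rewrite addr0.
Qed.

End schwartz_gauss.

Lemma Rintegral_sum d (T : measurableType d) (R : realType)
    (m : {measure set T -> \bar R}) I (r : seq I) (f : I -> T -> R) :
  (forall i, m.-integrable setT (EFin \o f i)) ->
  m.-integrable setT (EFin \o (fun x => \sum_(i <- r) f i x)) /\
  \int[m]_x (\sum_(i <- r) f i x) = \sum_(i <- r) \int[m]_x f i x.
Proof.
move=> intf; elim: r => [|i r [IHi IHe]].
  have -> : (fun x => \sum_(i <- [::]) f i x) = cst 0.
    by apply/funext => x; rewrite big_nil.
  by rewrite big_nil Rintegral_cst// mul0r; split=> //; exact: integrable0.
have -> : (fun x => \sum_(j <- i :: r) f j x) = (fun x => f i x + \sum_(j <- r) f j x).
  by apply/funext => x; rewrite big_cons.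
split; first exact: (integrableD _ (intf i) IHi).
by rewrite RintegralD// IHe big_cons.
Qed.

(** * Fourier transforms of modulated Gaussians *)

Section gauss_kernel.
Context {R : realType} {d : nat}.
Local Notation rV := 'rV[R]_d.
Local Notation nu := (@lebesgue_rV R d).
Implicit Types (x z w : rV).

Lemma gauss_ge0 s x : 0 <= gauss s x. Proof. exact: expR_ge0. Qed.

Lemma gaussN s x : gauss s (- x) = gauss s x.
Proof.
by rewrite /gauss -(scaleN1r x) dotvZl dotvC dotvZl !mulN1r opprK.
Qed.

Lemma integral_gaussB s z : 0 < s ->
  nu.-integrable setT (EFin \o (fun x => gauss s (x - z))) /\
  \int[nu]_x gauss s (x - z) = Num.sqrt (pi / s) ^+ d.
Proof.
move=> s0.
have [] := @lebesgue_rV_prod R d (fun i y => gauss1 s (y - z ord0 i))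
  (fun i => integrable_gauss1B _ s0).
have -> : (fun x : rV => \prod_(i < d) gauss1 s (x ord0 i - z ord0 i)) =
    (fun x => gauss s (x - z)).
  by apply/funext => x; rewrite gaussE; apply: eq_bigr => i _; rewrite !mxE.
move=> ? ->; split => //.
by under eq_bigr do rewrite integral_gauss1B//; rewrite prodr_const card_ord.
Qed.

Let C0 : R := (2 * pi) `^ (- (d%:R / 2)).

Definition gamp (e : R) : R := C0 * Num.sqrt (pi / e) ^+ d / 2.

(** Two bumps of width of order [Num.sqrt e], centred at [z] and [- z]: the Fourier transform of
    [gauss e] modulated by the frequency [z]. *)
Definition ghat (e : R) (z w : rV) : R :=
  gamp e * gauss (4 * e)^-1 (w - z) + gamp e * gauss (4 * e)^-1 (w + z).

Lemma fourier_re_gauss e z : 0 < e ->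
  fourier_re (fun x => gauss e x * cos (dotv x z)) = ghat e z.
Proof.
move=> e0; apply/funext => w; rewrite /fourier_re /ghat /gamp.
have [i1 e1] := integral_gauss_cos (w - z) e0.
have [i2 e2] := integral_gauss_cos (w + z) e0.
rewrite -/C0.
have -> : (fun x : rV => gauss e x * cos (dotv x z) * cos (dotv x w)) =
    (fun x => 2^-1 * (gauss e x * cos (dotv x (w - z)) + gauss e x * cos (dotv x (w + z)))).
  apply/funext => x; rewrite !(dotvC x) !dotvDl -(scaleN1r z) dotvZl mulN1r cosB cosD.
  by field.
rewrite RintegralZl//; last exact: (integrableD _ i1 i2).
by rewrite RintegralD// e1 e2; ring.
Qed.

Definition gmass : R := C0 * (2 * pi) ^+ d.

Lemma gmass_gt0 : 0 < gmass.
Proof. by rewrite mulr_gt0 ?powR_gt0 ?exprn_gt0 ?mulr_gt0 ?pi_gt0. Qed.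

Lemma gamp_ge0 e : 0 <= gamp e.
Proof. by rewrite divr_ge0 ?mulr_ge0 ?powR_ge0 ?exprn_ge0 ?sqrtr_ge0. Qed.

Let integral_gampB e z : 0 < e ->
  nu.-integrable setT (EFin \o (fun w => gamp e * gauss (4 * e)^-1 (w - z))) /\
  \int[nu]_w (gamp e * gauss (4 * e)^-1 (w - z)) = gmass / 2.
Proof.
move=> e0; have e4 : 0 < (4 * e)^-1 by rewrite invr_gt0 mulr_gt0.
have [ig eg] := integral_gaussB z e4.
split; first exact: (integrableZl _ _ ig).
rewrite RintegralZl// eg /gamp /gmass mulrAC; congr (_ / 2).
(* The square roots of [pi / e] and of [4 * pi * e] multiply to [2 * pi], so the dependence on [e]
   cancels. *)
rewrite -mulrA; congr (_ * _); rewrite -exprMn; congr (_ ^+ _).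
rewrite -sqrtrM ?divr_ge0 ?pi_ge0 ?(ltW e0)// invrK.
rewrite [X in Num.sqrt X](_ : _ = (2 * pi) ^+ 2); last by field; rewrite gt_eqF.
by rewrite sqrtr_sqr ger0_norm// mulr_ge0// pi_ge0.
Qed.

Lemma integral_ghat e z : 0 < e ->
  nu.-integrable setT (EFin \o ghat e z) /\ \int[nu]_w ghat e z w = gmass.
Proof.
move=> e0; have [i1 e1] := integral_gampB z e0; have [i2 e2] := integral_gampB (- z) e0.
have E : (fun w => gamp e * gauss (4 * e)^-1 (w + z)) =
    (fun w => gamp e * gauss (4 * e)^-1 (w - - z)).
  by apply/funext => w; rewrite opprK.
rewrite /ghat -E in i2 e2 *.
split; first exact: (integrableD _ i1 i2).
by rewrite RintegralD// e1 e2 -splitr.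
Qed.

Lemma ghat_ge0 e z w : 0 <= ghat e z w.
Proof. by rewrite addr_ge0// mulr_ge0 ?gamp_ge0 ?gauss_ge0. Qed.

(** Away from its centre a narrow bump is small relative to the bump of parameter 1. The latter is a
    usable majorant because [Phi] is integrable against [ghat 1 z]. *)
Lemma gauss_tail (D : R) : 0 < D -> exists2 K, 0 <= K &
  forall e (u : rV), 0 < e <= 1 -> D ^+ 2 <= dotv u u ->
  gamp e * gauss (4 * e)^-1 u <= K * e * (gamp 1 * gauss (4 * 1)^-1 u).
Proof.
move=> D0; pose a := D ^+ 2 / 4.
have a0 : 0 < a by rewrite divr_gt0 ?exprn_gt0.
(* Of the [d + 2] powers of [t], where [t ^+ 2 = e^-1], [d] absorb the growth of [gamp e] and two
   yield the factor [e]. *)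
have [M hM] := polyM_gauss_bounded d.+2 a0.
have M0 : 0 <= M.
  by apply: le_trans (hM 0 (lexx _)); rewrite mulr_ge0 ?expR_ge0 ?exprn_ge0 ?addr_ge0.
exists (expR a * M); first by rewrite mulr_ge0 ?expR_ge0.
move=> e u /andP[e0 e1] Du; pose t := Num.sqrt e^-1.
have t0 : 0 < t by rewrite sqrtr_gt0 invr_gt0.
have t2 : t ^+ 2 = e^-1 by rewrite sqr_sqrtr// invr_ge0 ltW.
have gE : gamp e = gamp 1 * t ^+ d.
  by rewrite /gamp divr1 sqrtrM ?pi_ge0// exprMn /t; ring.
have uE : gauss (4 * e)^-1 u = gauss (4 * 1)^-1 u * expR (- ((e^-1 - 1) / 4 * dotv u u)).
  by rewrite /gauss -expRD; congr expR; field; rewrite gt_eqF.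
have expb : expR (- ((e^-1 - 1) / 4 * dotv u u)) <= expR a * expR (- (a * t ^+ 2)).
  rewrite -expRD ler_expR t2 /a.
  have : 0 <= (e^-1 - 1) / 4 by rewrite divr_ge0// subr_ge0 invf_ge1.
  by move: Du; nra.
have tb : t ^+ d * expR (- (a * t ^+ 2)) <= M * e.
  rewrite -ler_pdivrMr// -t2 mulrAC -exprD addn2.
  apply: le_trans (hM t (ltW t0)); rewrite ler_wpM2r ?expR_ge0//.
  by rewrite lerXn2r ?nnegrE ?addr_ge0 ?(ltW t0)// lerDr.
rewrite gE uE.
rewrite (_ : _ * _ * (_ * _) = gamp 1 * gauss (4 * 1)^-1 u *
  (t ^+ d * expR (- ((e^-1 - 1) / 4 * dotv u u)))); last by ring.
rewrite [leRHS]mulrC ler_wpM2l ?(mulr_ge0 (gamp_ge0 _) (gauss_ge0 _ _))//.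
apply: (@le_trans _ _ (expR a * (t ^+ d * expR (- (a * t ^+ 2))))).
  by rewrite [leRHS]mulrCA ler_wpM2l ?exprn_ge0 ?(ltW t0).
by rewrite -[leRHS]mulrA ler_wpM2l ?expR_ge0.
Qed.

End gauss_kernel.

(** * Recovering values of [Phi] from mollified integrals *)

Section approximation.
Context {R : realType} {d : nat}.
Local Notation rV := 'rV[R]_d.
Local Notation nu := (@lebesgue_rV R d).
Implicit Types (x z w : rV).

(** The topology of row vectors is that of the maximum norm, which the Euclidean norm dominates. *)
Lemma continuous_near_euclid (Phi : rV -> R) z e : continuous Phi -> 0 < e ->
  exists2 D, 0 < D & forall x, dotv (x - z) (x - z) < D ^+ 2 -> `|Phi x - Phi z| <= e.
Proof.
move=> cPhi e0; have /cvgrPdist_le/(_ e e0) := cPhi z.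
move=> /nbhs_ballP[D /= D0 hD]; exists D => // x xz.
rewrite distrC; apply: hD; split=> [|i j]; first exact: D0.
rewrite (ord1 i) /ball/=.
have -> : z ord0 j - x ord0 j = - (x - z) ord0 j by rewrite !mxE opprB.
rewrite normrN; apply: le_lt_trans (coord_le_enorm _ _) _.
by rewrite -(ltr_pXn2r (n:=2)) ?nnegrE ?sqrtr_ge0 ?(ltW D0)// enorm_sqr.
Qed.

(** Half of the mass concentrates at [z] and half at [- z], where [Phi] takes the same value. Near
    the centres continuity costs half of [eta]; elsewhere [gauss_tail] gives [K * e] times the fixed
    integrable function [A]. *)
Lemma ghat_approx (Phi : rV -> R) z : continuous Phi -> Phi (- z) = Phi z ->
  (forall e, 0 < e -> nu.-integrable setT (EFin \o (Phi \* ghat e z))) ->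
  forall eta, 0 < eta -> exists2 e0, 0 < e0 & forall e, 0 < e <= e0 ->
    `|\int[nu]_w (Phi w * ghat e z w) - @gmass R d * Phi z| <= eta.
Proof.
move=> cPhi PhiN iPhi eta eta0.
have M0 : 0 < @gmass R d := gmass_gt0.
pose eta1 := eta / (2 * @gmass R d).
have eta10 : 0 < eta1 by rewrite divr_gt0// mulr_gt0.
have [D1 D10 hD1] := continuous_near_euclid z cPhi eta10.
have [D2 D20 hD2] := continuous_near_euclid (- z) cPhi eta10.
pose D := Num.min D1 D2.
have D0 : 0 < D by rewrite lt_min D10 D20.
have [K K0 hK] := @gauss_tail R d D D0.
pose g e u := @gamp R d e * @gauss R d (4 * e)^-1 u.
have g0 e u : 0 <= g e u by rewrite mulr_ge0 ?gamp_ge0 ?gauss_ge0.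
pose A w := (`|Phi w| + `|Phi z|) * ghat 1 z w.
have point e w : 0 < e <= 1 ->
    `|Phi w - Phi z| * ghat e z w <= eta1 * ghat e z w + K * e * A w.
  move=> e01; have e0 : 0 <= e by case/andP: e01 => /ltW.
  have side u : (dotv u u < D ^+ 2 -> `|Phi w - Phi z| <= eta1) ->
      `|Phi w - Phi z| * g e u <= eta1 * g e u + K * e * ((`|Phi w| + `|Phi z|) * g 1 u).
    have B0 : 0 <= (`|Phi w| + `|Phi z|) * g 1 u by rewrite mulr_ge0 ?addr_ge0.
    move=> near; have [/near h|far] := ltP (dotv u u) (D ^+ 2).
      apply: (@le_trans _ _ (eta1 * g e u)); first by rewrite ler_wpM2r.
      by rewrite lerDl (mulr_ge0 _ B0)// mulr_ge0.
    apply: (@le_trans _ _ (K * e * ((`|Phi w| + `|Phi z|) * g 1 u))); last first.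
      by rewrite lerDr (mulr_ge0 (ltW eta10)).
    rewrite [leRHS]mulrCA; apply: ler_pM => //; first exact: ler_normB.
    exact: hK.
  have s1 : dotv (w - z) (w - z) < D ^+ 2 -> `|Phi w - Phi z| <= eta1.
    move=> h; apply: hD1; apply: lt_le_trans h _.
    by rewrite lerXn2r ?nnegrE ?(ltW D0) ?(ltW D10)// ge_min lexx.
  have s2 : dotv (w + z) (w + z) < D ^+ 2 -> `|Phi w - Phi z| <= eta1.
    move=> h; rewrite -PhiN; apply: hD2; rewrite opprK; apply: lt_le_trans h _.
    by rewrite lerXn2r ?nnegrE ?(ltW D0) ?(ltW D20)// ge_min lexx orbT.
  have := lerD (side _ s1) (side _ s2); rewrite /A /ghat -/(g e _) -/(g e _).
  by rewrite -/(g 1 _) -/(g 1 _) -!mulrDr addrACA -!mulrDr.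
have iA : nu.-integrable setT (EFin \o A).
  have i1 := integrable_norm (iPhi 1 ltr01).
  have i2 := integrableZl measurableT (`|Phi z|) (integral_ghat z (@ltr01 R)).1.
  apply: eq_integrable (integrableD _ i1 i2) => // w _ /=.
  by rewrite -EFinM -EFinD normrM (ger0_norm (ghat_ge0 _ _ _)) -mulrDl.
have IA0 : 0 <= \int[nu]_w A w.
  apply: Rintegral_ge0 => w _; apply: mulr_ge0; first exact: addr_ge0.
  exact: ghat_ge0.
(* The added 1 keeps the denominator positive even if [K] or the integral of [A] is 0. *)
pose e1 := eta / (2 * (K * (\int[nu]_w A w) + 1)).
have KI0 : 0 < K * (\int[nu]_w A w) + 1 by rewrite ltr_wpDl// mulr_ge0.
have e10 : 0 < e1 by rewrite divr_gt0// mulr_gt0.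
exists (Num.min 1 e1); first by rewrite lt_min ltr01.
move=> e; rewrite le_min => /and3P[e0 e_1 ee1].
have [ig eg] := integral_ghat z e0.
have -> : @gmass R d * Phi z = \int[nu]_w (Phi z * ghat e z w).
  by rewrite RintegralZl// eg mulrC.
have iz := integrableZl measurableT (Phi z) ig.
have iB := integrableB measurableT (iPhi e e0) iz.
rewrite -RintegralB//; last exact: iPhi.
apply: (le_trans (le_normr_Rintegral measurableT iB)).
have i3 : nu.-integrable setT (EFin \o (fun w => eta1 * ghat e z w)) :=
  integrableZl measurableT eta1 ig.
have i4 : nu.-integrable setT (EFin \o (fun w => K * e * A w)) :=
  integrableZl measurableT (K * e) iA.
apply: (@le_trans _ _ (\int[nu]_w (eta1 * ghat e z w + K * e * A w))).
  apply: le_Rintegral => //.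
  - exact: integrable_norm iB.
  - exact: (integrableD _ i3 i4).
  - move=> w _ /=; rewrite -mulrBl normrM (ger0_norm (ghat_ge0 _ _ _)).
    by apply: point; rewrite e0.
rewrite RintegralD// !RintegralZl// eg.
rewrite [leRHS]splitr lerD//.
  by rewrite /eta1 le_eqVlt; apply/orP; left; apply/eqP; field; rewrite gt_eqF.
apply: (@le_trans _ _ (e1 * (K * \int[nu]_w A w + 1))).
  rewrite mulrAC mulrC ler_pM ?mulr_ge0 ?(ltW e0)//.
  by rewrite lerDl.
by rewrite /e1 le_eqVlt; apply/orP; left; apply/eqP; field; rewrite gt_eqF.
Qed.

End approximation.

(** * Comparison with a Gaussian kernel *)

(** From [s * (1 + t) <= 1 + s * t <= K * expR (s * t / (2 * tau))], the power [tau] uses half of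
    the exponent [s * t]; since [2 * e <= s], the other half pays for the factor with [e]. *)
Lemma powR_ge_gauss {R : realType} (tau : R) : 0 < tau ->
  exists2 k : R, 0 < k & forall s e t : R, 0 < s <= 1 -> 2 * e <= s -> 0 <= t ->
  k * s `^ tau * expR (- (s * t)) <= (1 + t) `^ (- tau) * expR (- (e * t)).
Proof.
move=> tau0; pose K := 1 + 2 * tau.
have K0 : 0 < K by rewrite addr_gt0// mulr_gt0.
exists (K `^ tau)^-1; first by rewrite invr_gt0 powR_gt0.
move=> s e t /andP[s0 s1] es t0.
have st0 : 0 <= s * t by rewrite mulr_ge0// ltW.
have t1 : 0 < 1 + t by rewrite ltr_wpDr.
have key : (s * (1 + t)) `^ tau <= K `^ tau * expR (s * t / 2).
  have -> : expR (s * t / 2) = expR (s * t / (2 * tau)) `^ tau.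
    by rewrite -expRM; congr expR; field; rewrite gt_eqF.
  rewrite -powRM ?(ltW K0) ?expR_ge0//.
  apply: ge0_ler_powR; rewrite ?nnegrE ?(ltW tau0)//.
  - by rewrite mulr_ge0 ?ltW.
  - by rewrite mulr_ge0 ?expR_ge0 ?ltW.
  apply: (@le_trans _ _ (K * (1 + s * t / (2 * tau)))); last first.
    by rewrite ler_wpM2l ?(ltW K0)// expR_ge1Dx.
  have -> : K * (1 + s * t / (2 * tau)) = 1 + s * t + (2 * tau + s * t / (2 * tau)).
    by rewrite /K; field; rewrite gt_eqF.
  have : 0 <= 2 * tau + s * t / (2 * tau).
    by rewrite addr_ge0 ?divr_ge0// mulr_ge0// ltW.
  by rewrite mulrDr mulr1; lra.
rewrite powRN -(ler_pM2l (powR_gt0 tau t1)) [leRHS]mulrA divff ?gt_eqF ?powR_gt0// mul1r.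
rewrite -(ler_pM2l (expR_gt0 (s * t))) -expRD.
rewrite (_ : expR (s * t) * _ = (K `^ tau)^-1 * (s * (1 + t)) `^ tau); last first.
  rewrite powRM ?(ltW s0) ?(ltW t1)//.
  have E : expR (s * t) * expR (- (s * t)) = 1 by rewrite -expRD subrr expR0.
  by rewrite -[RHS]mul1r -E; ring.
rewrite mulrC ler_pdivrMr ?powR_gt0//; apply: (le_trans key).
rewrite mulrC ler_wpM2r ?powR_ge0// ler_expR.
by have := ler_wpM2r t0 es; lra.
Qed.

Section comparison.
Context {R : realType} {d : nat}.
Local Notation rV := 'rV[R]_d.
Local Notation nu := (@lebesgue_rV R d).
Implicit Types (x z w : rV).

Definition qform (I : finType) (Phi : rV -> R) (c : I -> R) (z : I -> rV) : R :=
  \sum_p \sum_q c p * c q * Phi (z p - z q).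

Lemma qformE (I : finType) (Phi : rV -> R) (c : I -> R) (z : I -> rV) :
  qform Phi c z = \sum_(pq : I * I) c pq.1 * c pq.2 * Phi (z pq.1 - z pq.2).
Proof. by rewrite /qform pair_big. Qed.

(** The form is the squared modulus of the exponential sum with coefficients [c p] and phases
    [dotv w (z p)]. *)
Lemma qform_cos_ge0 (I : finType) (c : I -> R) (z : I -> rV) w :
  0 <= qform (fun u => cos (dotv w u)) c z.
Proof.
have -> : qform (fun u => cos (dotv w u)) c z =
    (\sum_p c p * cos (dotv w (z p))) ^+ 2 + (\sum_p c p * sin (dotv w (z p))) ^+ 2.
  rewrite /qform !expr2 !mulr_suml -big_split; apply: eq_bigr => p _ /=.
  rewrite !mulr_sumr -big_split; apply: eq_bigr => q _ /=.
  rewrite dotvC dotvDl -(scaleN1r (z q)) dotvZl mulN1r cosB !(dotvC _ w).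
  by ring.
by rewrite addr_ge0 ?sqr_ge0.
Qed.

Lemma qform_gauss s (I : finType) (c : I -> R) (z : I -> rV) : 0 < s ->
  nu.-integrable setT
    (EFin \o (fun w => gauss s w * qform (fun u => cos (dotv w u)) c z)) /\
  \int[nu]_w (gauss s w * qform (fun u => cos (dotv w u)) c z) =
  Num.sqrt (pi / s) ^+ d * qform (gauss (4 * s)^-1) c z.
Proof.
move=> s0.
pose f (pq : I * I) w := c pq.1 * c pq.2 * (gauss s w * cos (dotv w (z pq.1 - z pq.2))).
have [intf ef] : nu.-integrable setT (EFin \o (fun w => \sum_(i <- index_enum _) f i w)) /\
  \int[nu]_w (\sum_(i <- index_enum _) f i w) = \sum_(i <- index_enum _) \int[nu]_w f i w.
  apply: Rintegral_sum => pq.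
  exact: (integrableZl _ _ (integral_gauss_cos _ s0).1).
have E : (fun w => gauss s w * qform (fun u => cos (dotv w u)) c z) =
    (fun w => \sum_(i <- index_enum _) f i w).
  apply/funext => w; rewrite qformE mulr_sumr; apply: eq_bigr => pq _.
  by rewrite /f mulrCA.
rewrite E; split=> //; rewrite ef qformE mulr_sumr; apply: eq_bigr => pq _.
have [i1 e1] := integral_gauss_cos (z pq.1 - z pq.2) s0.
by rewrite /f RintegralZl// e1 mulrCA.
Qed.

(** The easy half of Bochner's theorem. Since the map from [s] to [(4 * s)^-1] is an involution,
    every Gaussian arises as a transform in [qform_gauss]. *)
Lemma qform_gauss_ge0 s (I : finType) (c : I -> R) (z : I -> rV) : 0 < s ->
  0 <= qform (gauss s) c z.
Proof.
move=> s0; have s4 : 0 < (4 * s)^-1 by rewrite invr_gt0 mulr_gt0.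
have [_ e] := qform_gauss c z s4.
have -> : s = (4 * (4 * s)^-1)^-1 by field; rewrite gt_eqF.
rewrite -(pmulr_rge0 _ (_ : 0 < Num.sqrt (pi / (4 * s)^-1) ^+ d)); last first.
  by rewrite exprn_gt0// sqrtr_gt0 divr_gt0// pi_gt0.
rewrite -e; apply: Rintegral_ge0 => w _; rewrite mulr_ge0 ?gauss_ge0//.
exact: qform_cos_ge0.
Qed.

(** On the Fourier side both forms integrate the nonnegative [T], against [F] and against a
    Gaussian, so a pointwise bound suffices. Symmetry of [Phi] is asked only at differences of the
    points, where a symmetric kernel provides it. *)
Lemma gaussian_comparison (Phi : rV -> R) (tau : R) : 0 < tau ->
  continuous Phi -> fourier_decay Phi tau ->
  exists2 k : R, 0 < k & forall s (I : finType) (c : I -> R) (z : I -> rV),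
    0 < s <= 1 -> (forall p q, Phi (z p - z q) = Phi (z q - z p)) ->
    k * s `^ tau * Num.sqrt (pi / s) ^+ d * qform (gauss (4 * s)^-1) c z <=
    qform Phi c z.
Proof.
move=> tau0 cPhi [F [hF [cF [CF [cF0 _ boundF]]]]].
have [k1 k10 hk1] := powR_ge_gauss tau0.
have M0 : 0 < @gmass R d := gmass_gt0.
exists (cF * k1 / @gmass R d); first by rewrite divr_gt0// mulr_gt0.
move=> s I c z s01 Phi_sym; have s0 : 0 < s by case/andP: s01.
pose T w := qform (fun u => cos (dotv w u)) c z.
have sw e u : 0 < e ->
  [/\ nu.-integrable setT (EFin \o (fun w => F w * (gauss e w * cos (dotv w u)))),
      nu.-integrable setT (EFin \o (Phi \* ghat e u)) &
      \int[nu]_w (F w * (gauss e w * cos (dotv w u))) =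
      \int[nu]_w (Phi w * ghat e u w)].
  move=> e0; have [] := hF _ (schwartz_gauss_cos e0 u).
  by rewrite fourier_re_gauss.
(* [L] bounds the mollified forms from below uniformly in their width. *)
pose L := cF * k1 * s `^ tau * (Num.sqrt (pi / s) ^+ d * qform (gauss (4 * s)^-1) c z).
have low e : 0 < e -> 2 * e <= s ->
    L <= \sum_(pq : I * I) c pq.1 * c pq.2 *
      \int[nu]_w (Phi w * ghat e (z pq.1 - z pq.2) w).
  move=> e0 es.
  pose f (pq : I * I) w := c pq.1 * c pq.2 *
    (F w * (gauss e w * cos (dotv w (z pq.1 - z pq.2)))).
  have [intf ef] : nu.-integrable setT (EFin \o (fun w => \sum_(i <- index_enum _) f i w)) /\
    \int[nu]_w (\sum_(i <- index_enum _) f i w) = \sum_(i <- index_enum _) \int[nu]_w f i w.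
    apply: Rintegral_sum => pq.
    by have [i1 _ _] := sw e (z pq.1 - z pq.2) e0; exact: (integrableZl _ _ i1).
  have E : (fun w => \sum_(i <- index_enum _) f i w) = (fun w => F w * (gauss e w * T w)).
    apply/funext => w; rewrite /T qformE !mulr_sumr; apply: eq_bigr => pq _.
    by rewrite /f; ring.
  have -> : \sum_(pq : I * I) c pq.1 * c pq.2 *
      \int[nu]_w (Phi w * ghat e (z pq.1 - z pq.2) w) = \int[nu]_w (F w * (gauss e w * T w)).
    rewrite -E ef; apply: eq_bigr => pq _.
    by have [i1 _ <-] := sw e (z pq.1 - z pq.2) e0; rewrite /f RintegralZl.
  have [iT eT] := qform_gauss c z s0.
  rewrite /L -eT -RintegralZl//.
  apply: le_Rintegral => //.
  - exact: (integrableZl _ _ iT).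
  - by rewrite -E.
  move=> w _; rewrite -/(T w) !mulrA ler_wpM2r ?qform_cos_ge0//.
  have /andP[Fw _] := boundF w.
  apply: (@le_trans _ _ (cF * (1 + enorm w ^+ 2) `^ (- tau) * gauss e w)); last first.
    by rewrite ler_wpM2r ?gauss_ge0.
  rewrite -!mulrA ler_wpM2l ?(ltW cF0)// enorm_sqr mulrA.
  exact: hk1 s01 es (dotv_ge0 w).
suff h : L <= @gmass R d * qform Phi c z.
  rewrite (_ : _ * qform _ _ _ = L / @gmass R d); last by rewrite /L; ring.
  by rewrite ler_pdivrMr// mulrC.
apply/ler_addgt0Pr => eta eta0.
(* The added 1 keeps [N] positive when all coefficients vanish. *)
pose N := \sum_(pq : I * I) `|c pq.1 * c pq.2| + 1.
have N0 : 0 < N by rewrite ltr_wpDl// sumr_ge0.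
have etaN : 0 < eta / N by rewrite divr_gt0.
have app (pq : I * I) : exists e0, 0 < e0 /\ forall e, 0 < e <= e0 ->
    `|\int[nu]_w (Phi w * ghat e (z pq.1 - z pq.2) w) -
      @gmass R d * Phi (z pq.1 - z pq.2)| <= eta / N.
  have PhiN : Phi (- (z pq.1 - z pq.2)) = Phi (z pq.1 - z pq.2) by rewrite opprB.
  have iPhi e : 0 < e -> nu.-integrable setT (EFin \o (Phi \* ghat e (z pq.1 - z pq.2))).
    by move=> /(sw e (z pq.1 - z pq.2))[].
  have [e0 e00 he0] := ghat_approx cPhi PhiN iPhi etaN.
  by exists e0.
have [e_ he_] := choice app.
(* One width for all pairs: the least of finitely many thresholds, started at [s / 2] so that [low]
   applies. *)
pose e := \big[Num.min/(s / 2)]_(pq : I * I) e_ pq.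
have e0 : 0 < e.
  rewrite /e; elim/big_ind: _ => [||pq _].
  - by rewrite divr_gt0.
  - by move=> a b a0 b0; rewrite lt_min a0.
  - by have [] := he_ pq.
have es : 2 * e <= s.
  rewrite -ler_pdivlMl// mulrC /e.
  elim/big_rec: _ => [|pq a _ h]; first by [].
  by rewrite ge_min h orbT.
have ee (pq : I * I) : e <= e_ pq.
  by rewrite /e (bigD1 pq)//= ge_min lexx.
apply: (le_trans (low e e0 es)).
rewrite qformE mulr_sumr -lerBlDl -sumrB.
apply: (@le_trans _ _ (\sum_(pq : I * I) `|c pq.1 * c pq.2| * (eta / N))).
  apply: ler_sum => pq _; rewrite mulrCA -mulrBr.
  apply: le_trans (ler_norm _) _; rewrite normrM ler_wpM2l//.
  by have [_] := he_ pq; apply; rewrite e0 ee.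
rewrite -mulr_suml mulrA ler_pdivrMr// mulrC ler_wpM2l ?(ltW eta0)//.
by rewrite /N lerDl.
Qed.

End comparison.

(** * The lower bound *)

Section residual_trace.
Context {R : realType} {d : nat}.
Local Notation rV := 'rV[R]_d.

(** Formal combinations of the points, with the semi-inner product of the Gaussian kernel, stand in
    for its native space; a semidefinite form tolerates coinciding points. As [c] is arbitrary, it
    may come from projections for another kernel. *)
Lemma sum_qform_residual_ge s (J : finType) N (L : R) (y : J -> rV) (x : 'I_N -> rV)
    (c : J -> 'I_N -> R) : 0 < s -> 0 <= L ->
  (forall j, \sum_i gauss s (y j - y i) <= L) ->
  #|J|%:R - N%:R * L <=
  \sum_j qform (gauss s) (residual_coef (c j)) (cons_pt x (y j)).
Proof.
move=> s0 L0 rows.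
pose P := (J + 'I_N)%type.
pose pt (p : P) := match p with inl j => y j | inr i => x i end.
pose E : lmodType R := {ffun P -> R^o}.
pose B (u v : E) : R := \sum_p \sum_q u p * v q * gauss s (pt p - pt q).
pose e (p : P) : E := [ffun q => (q == p)%:R].
have Blin a u v w : B (a *: u + v) w = a * B u w + B v w.
  rewrite /B mulr_sumr -big_split; apply: eq_bigr => p _ /=.
  rewrite mulr_sumr -big_split; apply: eq_bigr => q _ /=.
  by rewrite !ffunE /GRing.scale/=; ring.
have Bsym u v : B u v = B v u.
  rewrite /B exchange_big; apply: eq_bigr => p _; apply: eq_bigr => q _.
  by rewrite -gaussN opprB [u _ * _]mulrC.
have B0 u : 0 <= B u u by exact: qform_gauss_ge0.
have Be p q : B (e p) (e q) = gauss s (pt p - pt q).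
  rewrite /B (bigD1 p)//= [X in _ + X]big1 ?addr0; last first.
    by move=> r /negPf rp; apply: big1 => t _; rewrite !ffunE rp !mul0r.
  rewrite (bigD1 q)//= [X in _ + X]big1 ?addr0 => [|t /negPf tq]; last first.
    by rewrite !ffunE tq mulr0 mul0r.
  by rewrite !ffunE !eqxx !mul1r.
have bes v : \sum_j B (e (inl j)) v ^+ 2 <= L * B v v.
  apply: (bessel_row_sum Blin Bsym B0) => // j.
  rewrite (eq_bigr (fun i => gauss s (y j - y i))) ?rows// => i _.
  by rewrite Be ger0_norm ?gauss_ge0.
have := sum_dist_span_ge Blin Bsym B0 (fun i => e (inr i)) c L0 bes.
have -> : \sum_j B (e (inl j)) (e (inl j)) = #|J|%:R.
  have g1 : gauss s (0 : rV) = 1.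
    by rewrite /gauss /dotv big1 ?mulr0 ?oppr0 ?expR0//; move=> i _; rewrite mxE mul0r.
  by under eq_bigr do rewrite Be subrr g1; rewrite sumr_const.
move=> /le_trans; apply; rewrite le_eqVlt; apply/orP; left; apply/eqP.
apply: eq_bigr => j _.
pose f (p : option 'I_N) : P := if p is Some i then inr i else inl j.
have -> : e (inl j) - \sum_(i < N) c j i *: e (inr i) =
    \sum_p residual_coef (c j) p *: e (f p).
  rewrite big_option /= scale1r; congr (_ + _).
  by rewrite -sumrN; apply: eq_bigr => i _; rewrite scaleNr.
rewrite (form_suml Blin) /qform; apply: eq_bigr => p _.
rewrite Bsym (form_suml Blin) mulr_sumr; apply: eq_bigr => q _.
have ptf r : pt (f r) = cons_pt x (y j) r by case: r.
rewrite Be !ptf mulrA; congr (_ * _).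
by rewrite -[LHS]gaussN opprB.
Qed.

End residual_trace.

(** * Row sums of the Gaussian Gram matrix over a grid *)

Section grid.
Context {R : realType}.

(** The distance [|m - k|]: under truncated subtraction at least one summand is 0. *)
Let dist (m k : nat) := (m - k + (k - m))%N.

(** Two geometric series: the indices up to [m] contribute at most 2, those beyond at most 1. *)
Lemma sum_half_dist_le3 n m : (m < n)%N ->
  \sum_(k < n) (2^-1 : R) ^+ dist m k <= 3.
Proof.
have half j : (2^-1 : R) ^+ j = 2 * 2^-1 ^+ j.+1 by rewrite exprS mulrA divff ?mul1r.
have half1 j : 2 ^+ j * (2^-1 : R) ^+ j = 1 by rewrite -exprMn divff ?expr1n.
have low i : (i <= m.+1)%N -> \sum_(k < i) (2^-1 : R) ^+ dist m k <= 2 ^+ i * 2^-1 ^+ m.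
  elim: i => [_|i IH im]; first by rewrite big_ord0 mulr_ge0 ?exprn_ge0.
  have -> : 2 ^+ i.+1 * (2^-1 : R) ^+ m = 2 ^+ i * 2^-1 ^+ m + 2 ^+ i * 2^-1 ^+ m.
    by rewrite exprS; ring.
  rewrite big_ord_recr/= lerD ?IH ?(ltnW im)//.
  have -> : dist m i = (m - i)%N.
    by rewrite /dist (_ : (i - m)%N = 0)%N ?addn0//; apply/eqP; rewrite subn_eq0.
  by rewrite -[in leRHS](subnKC (_ : i <= m)%N)// exprD mulrA half1 mul1r.
have high j : \sum_(k < m.+1 + j) (2^-1 : R) ^+ dist m k <= 3 - 2^-1 ^+ j.
  elim: j => [|j IH].
    rewrite addn0 (le_trans (low _ (leqnn _)))// exprS -mulrA half1 expr0; lra.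
  rewrite addnS big_ord_recr/=.
  have -> : dist m (m.+1 + j) = j.+1.
    by rewrite /dist addSn subSn ?leq_addr// addKn (_ : (m - _)%N = 0)%N//; apply/eqP;
      rewrite subn_eq0 -addnS leq_addr.
  by have := half j; lra.
move=> mn; rewrite -(subnKC mn) (le_trans (high _))// lerBlDr lerDl.
by rewrite exprn_ge0.
Qed.

Variable d : nat.
Local Notation rV := 'rV[R]_d.

(* With [h = 4 * q] and [s = q ^ 2], points chosen in the lower half of each
   cell of a grid of mesh [h] are at distance at least [h |i - j| / 2]. *)
Lemma grid_row_sum n (q : R) (x0 : rV) (y : {ffun 'I_d -> 'I_n} -> rV) : 0 < q ->
  (forall (t : {ffun 'I_d -> 'I_n}) i, x0 ord0 i + 4 * q * (t i)%:R <= y t ord0 i <=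
               x0 ord0 i + 4 * q * (t i)%:R + 2 * q) ->
  forall t, \sum_t' gauss (4 * q ^+ 2)^-1 (y t - y t') <= 3 ^+ d.
Proof.
move=> q0 yb t.
apply: (@le_trans _ _ (\sum_(t' : {ffun 'I_d -> 'I_n})
    \prod_i (2^-1 : R) ^+ dist (t i) (t' i))).
  apply: ler_sum => t' _; rewrite gaussE; apply: ler_prod => i _.
  rewrite expR_ge0/= !mxE.
  set D := dist _ _.
  have uD : D%:R * (2 * q) <= `|y t ord0 i - y t' ord0 i|.
    have := yb t i; have := yb t' i.
    set a := y t ord0 i; set b := y t' ord0 i; move=> /andP[b1 b2] /andP[a1 a2].
    (* Corners of cells [j < k] differ by [4 * q * (k - j)]; losing half a cell, [2 * q], still
       leaves [2 * q * (k - j)]. *)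
    have sep (j k : nat) (u v : R) : (j < k)%N -> u <= x0 ord0 i + 4 * q * j%:R + 2 * q ->
        x0 ord0 i + 4 * q * k%:R <= v -> (k - j)%:R * (2 * q) <= v - u.
      move=> jk hu hv; rewrite natrB ?(ltnW jk)//.
      have : (1 : R) <= k%:R - j%:R by rewrite -natrB ?(ltnW jk)// ler1n subn_gt0.
      by move: hu hv q0; nra.
    rewrite /D /dist ler_normr opprB; case: (ltngtP (t i) (t' i)) => [lt|gt|->].
    - rewrite (_ : (t i - t' i)%N = 0)%N ?add0n; last by apply/eqP; rewrite subn_eq0 ltnW.
      by rewrite (sep _ _ a b lt)// orbT.
    - rewrite (_ : (t' i - t i)%N = 0)%N ?addn0; last by apply/eqP; rewrite subn_eq0 ltnW.
      by rewrite (sep _ _ b a gt).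
    - by rewrite subnn mul0r subr_ge0 subr_ge0 le_total.
  have q20 : 0 < 2 * q by rewrite mulr_gt0.
  have -> : gauss1 (4 * q ^+ 2)^-1 (y t ord0 i - y t' ord0 i) =
      expR (- (`|y t ord0 i - y t' ord0 i| / (2 * q)) ^+ 2).
    by rewrite /gauss1 expr_div_n real_normK ?num_real//; congr expR; field; rewrite gt_eqF.
  set v := _ / _; have Dv : D%:R <= v by rewrite /v ler_pdivlMr.
  (* The exponent [v ^+ 2] is at least [D ^ 2], hence at least [D], so a factor at most [1 / 2] per
     unit of [D] suffices. *)
  have e2 : expR (- 1) <= 2^-1 :> R.
    rewrite expRN lef_pV2 ?posrE ?expR_gt0//.
    by apply: le_trans (expR_ge1Dx 1); rewrite -[2]natr1 addrC.
  apply: (@le_trans _ _ (expR (- 1) ^+ D)); last first.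
    by rewrite lerXn2r ?nnegrE ?expR_ge0.
  rewrite -expRM_natl ler_expR mulrN1 lerN2.
  apply: (@le_trans _ _ (D%:R ^+ 2)); last by rewrite lerXn2r ?nnegrE// (le_trans _ Dv).
  by rewrite -natrX ler_nat; case: (D) => // m; rewrite leq_pmulr.
(* The sum over all cells of a product over coordinates is a product of one-dimensional sums. *)
rewrite -(bigA_distr_bigA (fun i (k : 'I_n) => (2^-1 : R) ^+ dist (t i) k)).
rewrite -[X in 3 ^+ X]card_ord -prodr_const; apply: ler_prod => i _.
by rewrite sumr_ge0//= sum_half_dist_le3.
Qed.

End grid.

Lemma nat_root_approx {R : realType} (d N : nat) : (0 < d)%N -> (0 < N)%N ->
  exists2 m : nat, (0 < m)%N & (N <= m ^ d)%N /\ m%:R <= 2 * N%:R `^ (d%:R^-1) :> R.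
Proof.
move=> d0 N0; pose r : R := N%:R `^ (d%:R^-1).
have r1 : 1 <= r by rewrite -(powRr0 N%:R) ler_powR ?ler1n// invr_ge0.
(* The floor plus one exceeds the root by at most 1, hence by at most the root itself, by [r1]. *)
exists (Num.truncn r).+1 => //.
have rd : r ^+ d = N%:R.
  by rewrite -powR_mulrn ?powR_ge0// /r -powRrM mulVf ?powRr1// pnatr_eq0 -lt0n.
have r0 : 0 <= r by apply: le_trans r1.
have /andP[tr rt] := truncn_itv r0.
split.
  rewrite -(ler_nat R) natrX -rd lerXn2r ?nnegrE//.
  exact: ltW.
by rewrite -natr1 -/r; lra.
Qed.

(** * Power functions on a bounded domain *)

Section main.
Context {R : realType} {d : nat}.
Local Notation rV := 'rV[R]_d.
Local Notation nu := (@lebesgue_rV R d).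
Variable Omega : set rV.

Lemma open_box : open Omega -> Omega !=set0 ->
  exists x0 a, 0 < a <= 1 /\ rV_box x0 a `<=` Omega.
Proof.
move=> oO [x0 Ox0].
have : nbhs x0 Omega by exact: open_nbhs_nbhs.
move=> /nbhs_ballP[r /= r0 hr].
exists x0, (Num.min 1 (r / 2)); split.
  by rewrite lt_min ltr01 divr_gt0//= ge_min lexx.
move=> x hx; apply: hr; split=> // i j; rewrite (ord1 i) /ball/=.
have /andP[h1 h2] := hx j.
have : Num.min 1 (r / 2) <= r / 2 by rewrite ge_min lexx orbT.
by rewrite ler0_norm; lra.
Qed.

Lemma box_not_null x a (Z : set rV) : 0 < a -> measurable Z -> nu Z = 0%E ->
  exists2 y, rV_box x a y & ~ Z y.
Proof.
move=> a0 mZ Z0; apply: contrapT => h.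
have sub : rV_box x a `<=` Z.
  by move=> y yb; apply: contrapT => Zy; apply: h; exists y.
have := lebesgue_rV_box_gt0 x a0.
have : (nu (rV_box x a) <= nu Z)%E.
  by apply: le_measure => //; rewrite inE//; exact: measurable_rV_box.
by rewrite Z0 => /le_lt_trans h2 /h2; rewrite ltxx.
Qed.

Variables (k : Omega -> Omega -> R) (k_sym : is_kernel k) (H : native_space k).
Variable tau : R.
Hypotheses (d_gt0 : (0 < d)%N) (tau_gt : d%:R / 2 < tau).

Lemma power_function_gauss : translational_invariant_smoothness k tau ->
  exists2 K : R, 0 < K & forall s N (X : 'I_N -> Omega) (x : Omega), 0 < s <= 1 ->
    exists c : 'I_N -> R,
      K * s `^ tau * Num.sqrt (pi / s) ^+ d *
        qform (gauss (4 * s)^-1) (residual_coef c) (cons_pt (fun i => \val (X i)) (\val x))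
      <= power_function H X x ^+ 2.
Proof.
move=> [Phi [kE cPhi decay]].
have tau0 : 0 < tau by apply: le_lt_trans tau_gt; rewrite divr_ge0.
have [K K0 hK] := gaussian_comparison tau0 cPhi decay.
exists K => // s N X x s01.
have [c ->] := power_function_sqr H k_sym X x; exists c.
have ptE p : cons_pt (fun i => \val (X i)) (\val x) p = \val (cons_pt X x p) by case: p.
apply: le_trans (hK s _ (residual_coef c) _ s01 _) _.
  by move=> p q; rewrite !ptE -!kE k_sym.
rewrite le_eqVlt; apply/orP; left; apply/eqP.
by apply: eq_bigr => p _; apply: eq_bigr => q _; rewrite !ptE -kE.
Qed.

Lemma Linfty_normP (f : Omega -> R) v : Omega !=set0 -> open Omega ->
  (Linfty_norm f <= v%:E)%E ->
  exists2 Z, measurable Z /\ nu Z = 0%E & forall x : Omega, ~ Z (\val x) -> `|f x| <= v.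
Proof.
move=> On0 oO; rewrite /Linfty_norm unlock.
(* The norm of exponent [+oo] is defined as an essential supremum only when the whole space has
   positive measure. *)
have muT : (0 < nu setT)%E.
  have := lebesgue_rV_box_gt0 (0 : rV) (@ltr01 R) => /lt_le_trans; apply.
  by apply: le_measure; rewrite ?inE//; exact: measurable_rV_box.
rewrite muT => /ess_supP [Z [mZ Z0 hZ]].
exists Z => // x Zx; apply: contrapT => fx; apply/Zx/hZ => /= h.
by apply: fx; move: h; rewrite lee_fin /extend0 valK.
Qed.

Lemma Linfty_power_function_ge (X : forall N : nat, 'I_N -> Omega) :
  bounded_domain Omega -> translational_invariant_smoothness k tau ->
  exists2 cP : R, 0 < cP & forall N : nat, (0 < N)%N ->
    ((cP * N%:R `^ (1 / 2 - tau / d%:R))%:E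
         <= Linfty_norm (power_function H (X N)))%E.
Proof.
move=> [On0 oO _ _] /power_function_gauss[K K0 hK].
have [x0 [a [/andP[a0 a1] boxO]]] := open_box oO On0.
have d0 : 0 < d%:R :> R by rewrite ltr0n.
have a48 : 0 < a / 48 by rewrite divr_gt0.
(* Here [48 = 4 * 6 * 2], from [q = a / (4 * n)], [n = 6 * m] and the factor 2 bounding [m]. The
   final 2 accounts for the half of the total squared norm that the span may capture. *)
pose A := K * Num.sqrt pi ^+ d * (a / 48) `^ (2 * tau - d%:R) / 2.
have A0 : 0 < A.
  by rewrite divr_gt0// !mulr_gt0 ?powR_gt0// exprn_gt0// sqrtr_gt0 pi_gt0.
exists (Num.sqrt A); first by rewrite sqrtr_gt0.
move=> N N0.
have Lge0 : (0 <= Linfty_norm (power_function H (X N)))%E by exact: Lnorm_ge0.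
case E : (Linfty_norm (power_function H (X N))) => [v||]; last 2 first.
- by rewrite leey.
- by move: Lge0; rewrite E.
have [Z [mZ Z0] hZ] : exists2 Z, measurable Z /\ nu Z = 0%E &
    forall x : Omega, ~ Z (\val x) -> `|power_function H (X N) x| <= v.
  by apply: Linfty_normP => //; rewrite E.
have v0 : 0 <= v by move: Lge0; rewrite E.
have [m m0 [Nm mN]] := @nat_root_approx R d N d_gt0 N0.
(* With [6 = 2 * 3], the factor [3 ^ d] offsets the Bessel constant, and [2 ^ d >= 2] makes the
   captured part at most half of [n ^ d]. *)
have [n nE] : exists n, n = (6 * m)%N by exists (6 * m)%N.
have n0 : 0 < n%:R :> R by rewrite ltr0n nE muln_gt0.
(* The [n] cells of side [4 * q] fill each edge of the box exactly. *)
have [q qE] : exists q, q = a / (4 * n%:R) by exists (a / (4 * n%:R)).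
have q0 : 0 < q by rewrite qE divr_gt0// mulr_gt0.
have q1 : q ^+ 2 <= 1.
  rewrite expr_le1 ?(ltW q0)// qE ler_pdivrMr ?mulr_gt0// mul1r (le_trans a1)//.
  have : (1 : R) <= n%:R by rewrite ler1n -(ltr0n R).
  lra.
pose corner (t : {ffun 'I_d -> 'I_n}) : rV := \row_i (x0 ord0 i + 4 * q * (t i)%:R).
(* The lower half of a cell in every coordinate has positive measure, hence contains a point off
   [Z], where [v] bounds the power function. *)
have pick (t : {ffun 'I_d -> 'I_n}) : exists y : Omega,
    rV_box (corner t) (2 * q) (\val y) /\ ~ Z (\val y).
  have [|y yb Zy] := @box_not_null (corner t) (2 * q) Z _ mZ Z0; first by rewrite mulr_gt0.
  have Oy : Omega y.
    apply: boxO => i; have := yb i; rewrite !mxE.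
    have : (t i)%:R + 1 <= n%:R :> R by rewrite natr1 ler_nat.
    have : (0 : R) <= (t i)%:R by [].
    have -> : a = 4 * q * n%:R by rewrite qE; field; rewrite gt_eqF.
    move: q0; nra.
  by exists (exist _ y (mem_set Oy)).
have [y hy] := choice pick.
have s01 : 0 < q ^+ 2 <= 1 by rewrite exprn_gt0.
have [c hc] := choice (fun t => hK (q ^+ 2) N (X N) (y t) s01).
have s4 : 0 < (4 * q ^+ 2)^-1 by rewrite invr_gt0 mulr_gt0// exprn_gt0.
have L0 : 0 <= 3 ^+ d :> R by rewrite exprn_ge0.
have rows : forall t, \sum_t' gauss (4 * q ^+ 2)^-1 (\val (y t) - \val (y t')) <= 3 ^+ d.
  apply: (@grid_row_sum R d n q x0 (fun t => \val (y t)) q0) => t i.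
  by have [/(_ i)] := hy t; rewrite !mxE.
have := sum_qform_residual_ge (fun i => \val (X N i)) c s4 L0 rows.
set G := K * (q ^+ 2) `^ tau * Num.sqrt (pi / q ^+ 2) ^+ d in hc *.
have G0 : 0 < G.
  rewrite !mulr_gt0 ?powR_gt0 ?exprn_gt0// sqrtr_gt0 divr_gt0 ?pi_gt0//.
  by rewrite exprn_gt0.
move=> low.
have card : #|{ffun 'I_d -> 'I_n}|%:R = (n%:R ^+ d : R).
  by rewrite card_ffun !card_ord natrX.
have Nn : 2 * (N%:R * 3 ^+ d) <= n%:R ^+ d :> R.
  have : (2 * (N * 3 ^ d) <= n ^ d)%N.
    have -> : (n ^ d = 2 ^ d * (m ^ d * 3 ^ d))%N.
      by rewrite nE (_ : 6 = 2 * 3)%N// !expnMn -mulnA [(3 ^ d * _)%N]mulnC.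
    by rewrite leq_mul ?leq_mul// -{1}(expn1 2) leq_pexp2l.
  by rewrite -(ler_nat R) !natrM !natrX.
(* Averaging over the [n ^ d] points: each squared power function is at most [v ^+ 2], while the
   Gaussian residuals sum to at least half of [n ^ d]. *)
have Gv : G / 2 <= v ^+ 2.
  have M0 : 0 < n%:R ^+ d :> R by rewrite exprn_gt0.
  have sumv : G * (n%:R ^+ d - N%:R * 3 ^+ d) <= n%:R ^+ d * v ^+ 2.
    rewrite -card; apply: (le_trans (ler_wpM2l (ltW G0) low)); rewrite mulr_sumr.
    have -> : #|{ffun 'I_d -> 'I_n}|%:R * v ^+ 2 = \sum_(t : {ffun 'I_d -> 'I_n}) v ^+ 2.
      by rewrite sumr_const mulr_natl.
    apply: ler_sum => t _; apply: (le_trans (hc t)).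
    have [_ /hZ Pv] := hy t.
    by rewrite -real_normK ?num_real// lerXn2r ?nnegrE.
  rewrite -(ler_pM2l M0) (le_trans _ sumv)// mulrCA ler_wpM2l ?(ltW G0)//.
  by move: Nn; lra.
have AG : A * N%:R `^ (1 / 2 - tau / d%:R) ^+ 2 <= G / 2.
  pose r : R := N%:R `^ d%:R^-1.
  have r0 : 0 < r by rewrite powR_gt0// ltr0n.
  have e0 : 0 <= 2 * tau - d%:R by move: tau_gt; lra.
  have GE : G = K * Num.sqrt pi ^+ d * q `^ (2 * tau - d%:R).
    rewrite /G sqrtrM ?pi_ge0// sqrtrV ?exprn_ge0 ?(ltW q0)// sqrtr_sqr gtr0_norm//.
    rewrite exprMn exprVn -[q ^+ 2]powR_mulrn ?(ltW q0)// -powRrM.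
    rewrite powRD; last by rewrite (gt_eqF q0) implybT.
    rewrite powRN powR_mulrn ?(ltW q0)//.
    by ring.
  have qr : a / 48 * r^-1 <= q.
    rewrite qE -mulrA ler_wpM2l ?(ltW a0)// -invfM lef_pV2 ?posrE ?mulr_gt0//.
    by rewrite nE natrM; move: mN; rewrite -/r; lra.
  have pw : (a / 48) `^ (2 * tau - d%:R) * N%:R `^ (1 / 2 - tau / d%:R) ^+ 2 <=
      q `^ (2 * tau - d%:R).
    have -> : N%:R `^ (1 / 2 - tau / d%:R) ^+ 2 = r^-1 `^ (2 * tau - d%:R).
      rewrite -powR_mulrn ?powR_ge0// -powRrM /r -powRN -powRrM; congr (_ `^ _).
      by field; rewrite gt_eqF.
    rewrite -powRM ?(ltW a48) ?invr_ge0 ?(ltW r0)//.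
    apply: ge0_ler_powR => //; rewrite nnegrE ?(ltW q0)//.
    by rewrite mulr_ge0 ?(ltW a48)// invr_ge0 ltW.
  rewrite GE /A mulrAC ler_wpM2r// -[leLHS]mulrA ler_wpM2l//.
  by rewrite mulr_ge0 ?(ltW K0)// exprn_ge0// sqrtr_ge0.
rewrite lee_fin -(ler_pXn2r (n := 2)) ?nnegrE ?mulr_ge0 ?sqrtr_ge0 ?powR_ge0//.
rewrite exprMn sqr_sqrtr ?(ltW A0)//.
exact: le_trans AG Gv.
Qed.

End main.

Theorem theorem11 (R : realType) (d : nat) (d_gt0 : (0 < d)%N)
    (Omega : set 'rV[R]_d) (Omega_domain : bounded_domain Omega)
    (tau : R) (tau_gt : d%:R / 2 < tau)
    (k : Omega -> Omega -> R) (k_kernel : is_kernel k)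
    (k_smooth : translational_invariant_smoothness k tau)
    (H : native_space k) (H_sobolev : norm_equivalent_sobolev H tau)
    (X : forall N : nat, 'I_N -> Omega) (X_inj : forall N, injective (X N)) :
  exists2 cP : R, 0 < cP &
    forall N : nat, (0 < N)%N ->
      ((cP * N%:R `^ (1 / 2 - tau / d%:R))%:E
         <= Linfty_norm (power_function H (X N)))%E.
Proof.
exact: Linfty_power_function_ge.
Qed.
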